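(* Let $P:\{-1,1\}^k\to\{0,1\}$, let $2 \le t \le k$ and $\gamma > 0$. There is an efficient algorithm that, given $\mathcal{I} \sim \mathcal{F}_P(n,p)$, certifies that $\mathcal{I}$ is $(\gamma,t)$-quasirandom with high probability when $\bar{m} \ge \frac{2^{O(t)} n^{t/2} \log^5 n}{\gamma^2}$.
   Context: An instance $\mathcal{I}$ of CSP$(P)$ on variables $x_1,\dots,x_n$ is a multiset of constraints $(c,T)$ with $T\in[n]^k$, $c\in\{-1,1\}^k$ ($x_T=(x_{T_1},\dots,x_{T_k})$, $\circ$ entrywise product); $m=|\mathcal{I}|$. $\mathcal{F}_P(n,p)$ includes each of the $2^kn^k$ possible constraints independently with probability $p$; $\bar m=2^kn^kp$. For $x\in\{-1,1\}^n$ the induced distribution $\mathcal{D}_{\mathcal{I},x}$ on $\{-1,1\}^k$ assigns $\alpha$ probability $\frac1m\#\{(c,T)\in\mathcal{I}:c\circ x_T=\alpha\}$. A distribution $\mathcal{D}$ on $\{-1,1\}^k$ is $(\varepsilon,t)$-wise uniform if $|\mathbb{E}_{z\sim\mathcal{D}}[\prod_{i\in S}z_i]|\le\varepsilon$ for all $S\subseteq[k]$ with $0<|S|\le t$. $\mathcal{I}$ is $(\varepsilon,t)$-quasirandom if $\mathcal{D}_{\mathcal{I},x}$ is $(\varepsilon,t)$-wise uniform for every $x\in\{-1,1\}^n$. ''With high probability'': probability $1-o(1)$ as $n\to\infty$. An efficient certification algorithm runs in polynomial time, outputs the statement or ''fail'', never outputs the statement when false, and outputs ''fail'' with probability $o(1)$.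 $2^{O(t)}$ denotes $2^{Ct}$ for an absolute constant $C$. *)

(* Defs.v *)
From HB Require Import structures.
From mathcomp Require Import all_boot all_order all_algebra.
From mathcomp Require Import all_classical all_reals all_analysis.

Set Implicit Arguments.
Unset Strict Implicit.
Unset Printing Implicit Defensive.

Import Order.TTheory GRing.Theory Num.Theory.
Import numFieldNormedType.Exports.

Local Open Scope classical_set_scope.
Local Open Scope ring_scope.

(* The cube {-1,1}^k: the boolean b stands for the sign (-1) ^+ b, so that the
   product of two signs is the exclusive or [addb]. *)
Definition cube (k : nat) := {ffun 'I_k -> bool}.

Definition sgn (R : realType) (b : bool) : R := (-1) ^+ b.

Definition hadamard (k : nat) (c y : cube k) : cube k :=
  [ffun i => c i (+) y i].

Definition scope (k n : nat) := {ffun 'I_k -> 'I_n}.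

Definition restrict (k n : nat) (x : cube n) (T : scope k n) : cube k :=
  [ffun i => x (T i)].

Definition predicate (k : nat) := cube k -> bool.

(* The pair (c, T) is the constraint P (c o x_T) = 1. *)
Definition constraint (k : nat) (P : predicate k) (n : nat) : finType :=
  (cube k * scope k n)%type.

(* A multiset of constraints, given by a listing of it; all the notions below
   that are about the multiset do not depend on the order of the listing. *)
Definition instance (k : nat) (P : predicate k) (n : nat) :=
  seq (constraint P n).

(* D_{I,x}; for the empty instance, where it is not defined, this is the zero
   function since the library sets a / 0 = 0. *)
Definition induced (R : realType) (k : nat) (P : predicate k) (n : nat)
    (I : instance P n) (x : cube n) (a : cube k) : R :=
  (count (fun C : constraint P n => hadamard C.1 (restrict x C.2) == a) I)%:R
    / (size I)%:R.

Definition expectation (R : realType) (k : nat) (D : cube k -> R)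
    (f : cube k -> R) : R :=
  \sum_(z : cube k) D z * f z.

Definition wise_uniform (R : realType) (k : nat) (eps : R) (t : nat)
    (D : cube k -> R) : Prop :=
  forall S : {set 'I_k}, (0 < #|S| <= t)%N ->
    `| expectation D (fun z => \prod_(i in S) sgn R (z i)) | <= eps.

Definition quasirandom (R : realType) (k : nat) (P : predicate k) (eps : R)
    (t n : nat) (I : instance P n) : Prop :=
  forall x : cube n, wise_uniform eps t (induced R I x).

(* The law of F_P(n,p), as a mass function on sets of constraints. *)
Definition random_csp (R : realType) (k : nat) (P : predicate k) (n : nat)
    (p : R) (J : {set constraint P n}) : R :=
  \prod_(C : constraint P n) (if C \in J then p else 1 - p).

Definition prob_random_csp (R : realType) (k : nat) (P : predicate k) (n : nat)
    (p : R) (E : instance P n -> Prop) : R :=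
  \sum_(J : {set constraint P n} | `[< E (enum J) >]) random_csp p J.

Definition mean_size (R : realType) (k n : nat) (p : R) : R :=
  2 ^+ k * n%:R ^+ k * p.

(* Algorithms are programs for a deterministic random access machine with
   arbitrarily large natural numbers, timed by the logarithmic cost criterion
   (Aho, Hopcroft and Ullman), which makes polynomial time agree with
   polynomial time on Turing machines. The memory is a family of infinite
   arrays: [s a i] is cell i of array a, where a program names each array by
   a constant but computes the indices. *)
Definition memory := nat -> nat -> nat.

Inductive binop := Add | Sub | Mul | Div.

Inductive expr :=
| Const of nat
| Read of nat & expr
| Bin of binop & expr & expr.

Inductive program :=
| Skip
| Write of nat & expr & expr
| Seq of program & program
| If of expr & program & program
| While of expr & program.

Definition eval_binop (o : binop) : nat -> nat -> nat :=
  match o with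
  | Add => addn
  | Sub => subn
  | Mul => muln
  | Div => divn
  end.

Fixpoint eval (s : memory) (e : expr) : nat :=
  match e with
  | Const v => v
  | Read a i => s a (eval s i)
  | Bin o e1 e2 => eval_binop o (eval s e1) (eval s e2)
  end.

Definition bitlen (v : nat) : nat := (trunc_log 2 v).+1.

(* Each node of an expression, in particular the index of each cell that is
   read, costs the number of bits of its value. *)
Fixpoint cost (s : memory) (e : expr) : nat :=
  (bitlen (eval s e) +
   match e with
   | Const _ => 0
   | Read _ i => cost s i
   | Bin _ e1 e2 => cost s e1 + cost s e2
   end)%N.

Definition update (s : memory) (a i v : nat) : memory :=
  fun b j => if (b == a) && (j == i) then v else s b j.

(* [exec c s tm s']: from memory s, the program c halts after time tm in
   memory s'. Tests succeed on nonzero values. *)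
Inductive exec : program -> memory -> nat -> memory -> Prop :=
| exec_skip s : exec Skip s 1 s
| exec_write a i e s :
    exec (Write a i e) s (cost s i + cost s e)%N
      (update s a (eval s i) (eval s e))
| exec_seq c1 c2 s s1 s2 tm1 tm2 :
    exec c1 s tm1 s1 -> exec c2 s1 tm2 s2 ->
    exec (Seq c1 c2) s (tm1 + tm2)%N s2
| exec_if e c1 c2 s s1 tm :
    exec (if eval s e != 0%N then c1 else c2) s tm s1 ->
    exec (If e c1 c2) s (cost s e + tm)%N s1
| exec_while_stop e c s :
    eval s e = 0%N -> exec (While e c) s (cost s e) s
| exec_while_step e c s s1 s2 tm1 tm2 :
    eval s e <> 0%N -> exec c s tm1 s1 -> exec (While e c) s1 tm2 s2 ->
    exec (While e c) s (cost s e + tm1 + tm2)%N s2.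

(* The input is in array 0, one number per cell, and all other cells are 0. *)
Definition load (w : seq nat) : memory :=
  fun a i => if a == 0%N then nth 0%N w i else 0%N.

Definition encode_constraint (k : nat) (P : predicate k) (n : nat)
    (C : constraint P n) : seq nat :=
  [seq nat_of_bool (C.1 i) | i <- enum 'I_k] ++
  [seq nat_of_ord (C.2 i) | i <- enum 'I_k].

Definition encode (k : nat) (P : predicate k) (n : nat) (I : instance P n) :
    seq nat :=
  [:: n, size I & flatten [seq encode_constraint C | C <- I]].

(* The answer is in cell 0 of array 1 when the program halts: 0 stands for
   "fail", any other value for the statement to be certified. *)
Definition asserts (k : nat) (P : predicate k) (A : program) (n : nat)
    (I : instance P n) : Prop :=
  exists tm s, exec A (load (encode I)) tm s /\ s 1%N 0%N <> 0%N.

(* Time polynomial in the number of variables and the number of constraints,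
   the arity being fixed. *)
Definition poly_time (k : nat) (P : predicate k) (A : program) : Prop :=
  exists q : {poly nat}, forall (n : nat) (I : instance P n),
    exists tm s, exec A (load (encode I)) tm s /\ (tm <= q.[(n + size I)%N])%N.

Definition sound (k : nat) (P : predicate k)
    (Q : forall n, instance P n -> Prop) (A : program) : Prop :=
  forall (n : nat) (I : instance P n), asserts A I -> Q n I.

Definition succeeds_whp (R : realType) (k : nat) (P : predicate k)
    (p : nat -> R) (A : program) : Prop :=
  (fun n : nat =>
     prob_random_csp (p n) (fun I : instance P n => ~ asserts A I))
    @ \oo --> (0 : R).

(* Main.v *)
From Pilot Require Import Defs.
From mathcomp Require Import all_boot all_order all_algebra.
From mathcomp Require Import all_classical all_reals all_analysis.
From mathcomp Require Import zify ring lra.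
Import Order.TTheory GRing.Theory Num.Theory.
Import numFieldNormedType.Exports.
Import Pilot.Defs.
Local Open Scope ring_scope.

Set Implicit Arguments.
Unset Strict Implicit.
Unset Printing Implicit Defensive.

(* Let S have size s = 2a + e with e = 0 or 1, and let z(x) be the sum over the
   constraints (c, T) of the product over S of c_i x_(T_i). Grouping the
   constraints by the coordinate left over when s is odd, Cauchy-Schwarz gives
   z^2 <= n^e (Diag + X' H X / 2): Diag sums over the pairs of constraints that
   agree on all of T_S, X is a vector of n^(2a) signs, and H is the symmetric
   matrix of the pairs that agree on the odd coordinate only, its rows and
   columns being pairs of a-tuples of variables. Cauchy-Schwarz applied r times
   bounds X' H X by the Frobenius norm of H^L with L = 2^r, and repeated squaring
   computes this norm in polynomial time when L is about log n.

   For a random instance the signs c allow to replace the indicators of the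
   constraints by the independent centered variables (indicator - p). The mean of
   the trace of H^(2L) is then a sum over closed walks whose steps are pairs of
   constraints, and only the walks in which every constraint is repeated
   contribute. A step repeats earlier constraints, for which there are O(L^2)
   choices, or introduces new ones. This bounds the mean by
   n^(2a) (O(L^2) m / n^(s/2))^(2L), where m is the mean size, and Markov's
   inequality concludes: the factor log^5 n in the hypothesis beats L^2 and all
   constants, so that the exponent C = 0 is enough. *)

(** * Timed runs of programs *)

(** The index of H mixes the two constraints of a pair: [vertex o] takes block [o] of both. If rows
    carried both blocks of C and columns both blocks of C', a step whose C repeats an earlier
    constraint would leave n^(2a) choices for the blocks of C'. Mixing leaves n^a, so that one new
    constraint never weighs more than 1 ([rate_fiber]), while two new ones weigh 1 together. Diag is
    kept out of H because a pair with C = C' has sign 1 and does not oscillate. Without it, a linked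
    pair consists of two distinct constraints, which makes the count of new constraints in a step
    exact. Diag itself is a sum of squares of mean at most m, so Markov's inequality suffices for
    it. The program handles natural numbers only. The parameter gamma enters through an integer g
    with g gamma >= 1, and denominators are cleared: for A = g^2 n^s H, the squared Frobenius norm
    of A^L is compared with (m^2)^(2L), where m is here the actual number of constraints. Of the
    bound m^2 wanted for g^2 z^2, one half is granted to Diag and one half to H. *)

Section Machine.
Local Open Scope nat_scope.
Implicit Types (s : memory) (c : program) (e : expr).

Lemma bitlen_le v b : 0 < b -> v < 2 ^ b -> bitlen v <= b.
Proof.
case: b => // b _ vb; rewrite /bitlen ltnS.
have [->|v0] := posnP v; first by rewrite trunc_log0.
by rewrite -ltnS -(ltn_exp2l _ _ (isT : 1 < 2)) (leq_ltn_trans _ vb) ?trunc_logP.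
Qed.

Lemma ltn_bitlen v : v < 2 ^ bitlen v.
Proof. exact: trunc_log_ltn. Qed.

(** [asserts] speaks of some halting run, and the timed analysis exhibits one: determinism
    identifies the two. *)
Lemma exec_det c s tm s' : exec c s tm s' ->
  forall tm' s'', exec c s tm' s'' -> s'' = s'.
Proof.
elim=> {c s tm s'}.
- by move=> s tm' s'' E; inversion E.
- by move=> a i e s tm' s'' E; inversion E.
- move=> c1 c2 s s1 s2 t1 t2 _ IH1 _ IH2 tm' s'' E; inversion E; subst.
  match goal with H : exec c1 s _ _, H' : exec c2 _ _ _ |- _ =>
    by rewrite (IH1 _ _ H) in H'; apply: IH2 H' end.
- move=> e c1 c2 s s1 tm _ IH tm' s'' E; inversion E; subst.
  match goal with H : exec (if _ then _ else _) _ _ _ |- _ => exact: IH H end.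
- by move=> e c s e0 tm' s'' E; inversion E; subst.
- move=> e c s s1 s2 t1 t2 e0 _ IH1 _ IH2 tm' s'' E; inversion E; subst=> //.
  match goal with H : exec c s _ _, H' : exec (While e c) _ _ _ |- _ =>
    by rewrite (IH1 _ _ H) in H'; apply: IH2 H' end.
Qed.

(** With one bound for the whole memory, the cost of an expression depends only on its syntax and on
    [b]. *)
Definition small b s := forall a i, s a i < 2 ^ b.

(** Number of blocks of [b] bits that hold the value. Under each of the four operations the lengths
    at most add up, so that [Bin] needs no case analysis. *)
Fixpoint width e : nat :=
  match e with
  | Const v => bitlen v
  | Read _ _ => 1
  | Bin _ e1 e2 => width e1 + width e2
  end.

Fixpoint weight e : nat :=
  width e + match e with
            | Const _ => 0
            | Read _ i => weight i
            | Bin _ e1 e2 => weight e1 + weight e2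
            end.

Lemma width_gt0 e : 0 < width e.
Proof. by elim: e => //= o e1 h1 e2 h2; rewrite addn_gt0 h1. Qed.

Lemma eval_lt b s e : 0 < b -> small b s -> eval s e < 2 ^ (width e * b).
Proof.
move=> b0 sb; elim: e => [v|a i _|o e1 IH1 e2 IH2] /=.
- by rewrite (leq_trans (ltn_bitlen v)) // leq_exp2l // leq_pmulr.
- by rewrite mul1n; apply: sb.
have h1 : 0 < width e1 * b by rewrite muln_gt0 width_gt0.
have h2 : 0 < width e2 * b by rewrite muln_gt0 width_gt0.
rewrite mulnDl expnD.
set A := 2 ^ (width e1 * b) in IH1 *; set B := 2 ^ (width e2 * b) in IH2 *.
have A2 : 2 <= A by rewrite /A -[X in X <= _]expn1 leq_exp2l.
have B2 : 2 <= B by rewrite /B -[X in X <= _]expn1 leq_exp2l.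
case: o => /=; nia.
Qed.

Lemma cost_le b s e : 0 < b -> small b s -> cost s e <= weight e * b.
Proof.
move=> b0 sb; elim: e => [v|a i IH|o e1 IH1 e2 IH2].
- by rewrite /= !addn0 leq_pmulr.
- rewrite /= mulnDl mul1n leq_add ?IH //; apply: bitlen_le b0 (sb _ _).
- rewrite [cost _ _]/= [weight _]/= mulnDl [(weight e1 + _) * b]mulnDl leq_add ?leq_add //.
  apply: bitlen_le; first by rewrite muln_gt0 addn_gt0 width_gt0.
  exact: (eval_lt (Bin o e1 e2) b0 sb).
Qed.

Definition runs c s T (Q : memory -> Prop) :=
  exists tm s', [/\ exec c s tm s', tm <= T & Q s'].

Lemma runs_weak c s T T' (Q Q' : memory -> Prop) :
  runs c s T Q -> T <= T' -> (forall s', Q s' -> Q' s') -> runs c s T' Q'.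
Proof.
move=> [tm [s' [E h q]]] TT QQ.
by exists tm, s'; split; [|exact: leq_trans TT|exact: QQ].
Qed.

Lemma runs_seq c1 c2 s T1 T2 Q :
  runs c1 s T1 (fun s1 => runs c2 s1 T2 Q) -> runs (Seq c1 c2) s (T1 + T2) Q.
Proof.
move=> [t1 [s1 [E1 h1 [t2 [s2 [E2 h2 q]]]]]].
by exists (t1 + t2), s2; split; [exact: exec_seq E1 E2|exact: leq_add|].
Qed.

Lemma runs_write b a i e s T (Q : memory -> Prop) : 0 < b -> small b s ->
  (weight i + weight e) * b <= T ->
  Q (update s a (eval s i) (eval s e)) -> runs (Write a i e) s T Q.
Proof.
move=> b0 sb bT q; exists (cost s i + cost s e), (update s a (eval s i) (eval s e)).
split=> //; first exact: exec_write.
by apply: leq_trans bT; rewrite mulnDl leq_add // cost_le.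
Qed.

Lemma runs_if b e c1 c2 s T (Q : memory -> Prop) : 0 < b -> small b s ->
  runs (if eval s e != 0 then c1 else c2) s T Q ->
  runs (If e c1 c2) s (weight e * b + T) Q.
Proof.
move=> b0 sb [tm [s' [E h q]]]; exists (cost s e + tm), s'.
by split=> //; [exact: exec_if|rewrite leq_add // cost_le].
Qed.

(** The invariant is indexed by the number of iterations done, which replaces a termination measure.
    The final failing test is charged as one more iteration, hence [N.+1]. *)
Lemma runs_while b e c s T N (Inv : nat -> memory -> Prop) : 0 < b ->
  (forall i s, i <= N -> Inv i s -> small b s) ->
  (forall i s, i < N -> Inv i s -> eval s e <> 0) ->
  (forall i s, i < N -> Inv i s -> runs c s T (Inv i.+1)) ->
  (forall s, Inv N s -> eval s e = 0) ->
  Inv 0 s ->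
  runs (While e c) s (N.+1 * (weight e * b + T)) (Inv N).
Proof.
move=> b0 sm nz bd z I0.
suff H d i s1 : d + i = N -> Inv i s1 ->
    runs (While e c) s1 (d.+1 * (weight e * b + T)) (Inv N).
  by apply: H I0; rewrite addn0.
elim: d i s1 => [|d IH] i s1 di Ii.
  rewrite add0n in di; subst i; exists (cost s1 e), s1; split=> //.
    by apply: exec_while_stop; exact: z.
  have := cost_le e b0 (sm _ _ (leqnn _) Ii); lia.
have iN : i < N by lia.
have [t1 [s2 [E1 h1 I2]]] := bd _ _ iN Ii.
have [|t2 [s3 [E2 h2 I3]]] := IH i.+1 s2 _ I2; first lia.
exists (cost s1 e + t1 + t2), s3; split=> //.
  by apply: exec_while_step E1 E2; exact: nz Ii.
have := cost_le e b0 (sm _ _ (ltnW iN) Ii); lia.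
Qed.

Definition var v := Read v (Const 0).

Definition For v e c :=
  Seq (Write v (Const 0) (Const 0))
      (While (Bin Sub e (var v))
             (Seq c (Write v (Const 0) (Bin Add (var v) (Const 1))))).

Lemma small_update b s a i v : small b s -> v < 2 ^ b -> small b (update s a i v).
Proof. by move=> sb vb a' i'; rewrite /update; case: ifP. Qed.

Lemma update_same s a i v : update s a i v a i = v.
Proof. by rewrite /update !eqxx. Qed.

Lemma update_out s a i v a' i' : a' != a -> update s a i v a' i' = s a' i'.
Proof. by rewrite /update => /negbTE ->. Qed.

(* [Inv i] describes the memory at the start of iteration [i], the counter
   being already set. *)
Lemma runs_for b v e c s T N (Inv : nat -> memory -> Prop) :
  0 < b -> N < 2 ^ b -> small b s ->
  (forall i s, i <= N -> Inv i s -> [/\ small b s, eval s e = N & s v 0 = i]) ->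
  (forall i s, i < N -> Inv i s -> runs c s T (fun s' =>
     [/\ small b s', s' v 0 = i & Inv i.+1 (update s' v 0 i.+1)])) ->
  Inv 0 (update s v 0 0) ->
  runs (For v e c) s (N.+1 * ((2 * weight e + 11) * b + T)) (Inv N).
Proof.
move=> b0 Nb sb inv body I0.
apply: (@runs_weak _ _ (2 * b + N.+1 * ((2 * weight e + 3) * b + (T + 6 * b))) _
    (Inv N)) => //; last by nia.
apply: runs_seq; apply: (runs_write b0 sb) => //.
apply: (@runs_weak _ _ (N.+1 * (weight (Bin Sub e (var v)) * b + (T + 6 * b))) _
   (Inv N)) => //; last first.
  have : width e <= weight e by case: (e) => *; rewrite leq_addr.
  rewrite [weight (Bin _ _ _)]/= => h; rewrite leq_mul2l /= leq_add2r leq_mul2r.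
  by apply/orP; right; rewrite /bitlen trunc_log0; lia.
apply: runs_while => //.
- by move=> i s1 iN /inv[].
- by move=> i s1 iN /inv[|_ /= -> ->]; lia.
- move=> i s1 iN I1; apply: runs_seq.
  apply: (runs_weak (body _ _ iN I1) (leqnn _)) => s2 [sb2 v2 I2].
  apply: (runs_write b0 sb2); last by rewrite /= v2 addn1.
  by rewrite /= /bitlen trunc_log0 trunc_log1 leq_mul2r orbT.
- by move=> s1 /inv[|_ /= -> ->]; lia.
Qed.

Definition iv := 2. Definition gv := 3. Definition av := 4.

(** Diagonal sums, matrices, squarings, copies and norms are all families of sums of one expression,
    so a single timing proof serves all of them. *)
Definition Table A Bi Bs e :=
  For iv Bi (Seq (Seq (Write av (Const 0) (Const 0))
                      (For gv Bs (Write av (Const 0) (Bin Add (var av) e))))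
                 (Write A (var iv) (var av))).

Definition agree (D : seq nat) s s' := forall a i, a \notin D -> s' a i = s a i.

Lemma runs_table b (A : nat) Bi Bs e s Ni Ns (F : nat -> nat -> nat) : 0 < b -> small b s ->
  Ni < 2 ^ b -> Ns < 2 ^ b -> (forall i, i < Ni -> \sum_(g < Ns) F i g < 2 ^ b) ->
  A \notin [:: iv; gv; av] ->
  let D : seq nat := [:: A; iv; gv; av] in
  (forall s', agree D s s' -> eval s' Bi = Ni) ->
  (forall s', agree D s s' -> eval s' Bs = Ns) ->
  (forall s' i g, agree D s s' -> s' iv 0 = i -> s' gv 0 = g ->
     i < Ni -> g < Ns -> eval s' e = F i g) ->
  runs (Table A Bi Bs e) s
    ((2 * weight Bi + 2 * weight Bs + 2 * weight e + 40) * b * Ni.+1 * Ns.+1)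
    (fun s' => [/\ small b s', agree D s s' &
       forall i, i < Ni -> s' A i = \sum_(g < Ns) F i g]).
Proof.
move=> b0 sb Nib Nsb Fb AD D eBi eBs eF.
have [Ai Ag Aa] : [/\ iv != A, gv != A & av != A].
  by split; apply: contraNneq AD => <-.
pose Inv i s' := [/\ small b s', agree D s s', s' iv 0 = i &
  forall i', i' < i -> s' A i' = \sum_(g < Ns) F i' g].
have I0 : Inv 0 (update s iv 0 0).
  split=> //; first by apply: small_update => //; rewrite expn_gt0.
  by move=> a i; rewrite !inE !negb_or => /and4P[_ ai _ _]; rewrite update_out.
have b1 : 1 < 2 ^ b by rewrite -[X in X < _](expn0 2) ltn_exp2l.
have upD s1 a i v : a \in D -> agree D s s1 -> agree D s (update s1 a i v).
  move=> aD s1D a' i' a'D; rewrite update_out ?s1D //.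
  by apply: contraNneq a'D => ->.
apply: runs_weak (runs_for (T := 2 * b +
    (Ns.+1 * ((2 * weight Bs + 11) * b + (2 * weight e + 6) * b)) + 10 * b)
    b0 Nib sb _ _ I0) _ _.
- by move=> i s1 iN [sb1 ag1 iv1 _]; split=> //; exact: eBi.
- move=> i s1 iN [sb1 ag1 iv1 A1].
  apply: runs_seq; apply: runs_seq.
  apply: (runs_write (T := 2 * b) b0 sb1) => //.
  pose In g s' := [/\ small b s', agree D s s', s' iv 0 = i & s' gv 0 = g /\
    [/\ forall i', i' < i -> s' A i' = \sum_(g < Ns) F i' g &
     s' av 0 = \sum_(g' < g) F i g']].
  have In0 : In 0 (update (update s1 av 0 0) gv 0 0).
    split; [| |by []|split=> //; split=> //].
    + by do 2!(apply: small_update; last by rewrite expn_gt0).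
    + by do 2!(apply: (upD); first by rewrite !inE eqxx ?orbT).
    + by move=> i' i'i; rewrite !update_out ?A1 // eq_sym.
    + by rewrite big_ord0.
  apply: runs_weak (runs_for (T := (2 * weight e + 6) * b) b0 Nsb _ _ _ In0) _ _.
  + by apply: small_update => //; rewrite expn_gt0.
  + by move=> g s2 gN [sb2 ag2 iv2 [gv2 _]]; split=> //; exact: eBs.
  + move=> g s2 gN [sb2 ag2 iv2 [gv2 [A2 av2]]].
    have ev : eval s2 (Bin Add (var av) e) = \sum_(g' < g.+1) F i g'.
      by rewrite /= av2 big_ord_recr /= (eF _ _ _ ag2 iv2 gv2).
    have evb : eval s2 (Bin Add (var av) e) < 2 ^ b.
      rewrite ev; apply: leq_ltn_trans (Fb _ iN).
      rewrite -(subnKC gN) big_split_ord /= leq_addr //.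
    apply: (runs_write b0 sb2); last first.
      have sb3 : small b (update s2 av 0 (eval s2 (Bin Add (var av) e))).
        exact: small_update.
      split; [by []|by []|].
      split; [| |by []|split=> //; split].
      * by apply: small_update => //; lia.
      * by do 2!(apply: (upD); first by rewrite !inE eqxx ?orbT).
      * by move=> i' i'i; rewrite !update_out ?A2 // eq_sym.
      * by rewrite update_out // update_same.
    rewrite leq_mul2r; apply/orP; right.
    have : width e <= weight e by case: (e) => *; rewrite leq_addr.
    rewrite /= /bitlen trunc_log0; lia.
  + by [].
  + move=> s2 [sb2 ag2 iv2 [gv2 [A2 av2]]].
    apply: (runs_write (T := 10 * b) b0 sb2); last first.
      have ev2 : eval s2 (var av) < 2 ^ b by rewrite /= av2; apply: Fb.
      split; [exact: small_update|by rewrite update_out|].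
      split; [| |by []|].
      * by apply: small_update; [exact: small_update|exact: leq_ltn_trans Nib].
      * by do 2!(apply: (upD); first by rewrite !inE eqxx ?orbT).
      * move=> i'; rewrite ltnS leq_eqVlt => /predU1P[->|i'i].
          by rewrite update_out 1?eq_sym // /update /= iv2 !eqxx.
        rewrite update_out 1?eq_sym // /update /= iv2 eqxx /=.
        by rewrite (ltn_eqF i'i) A2.
    by rewrite leq_mul2r orbT.
- have -> (x y w : nat) : Ni.+1 * ((2 * x + 11) * b + (2 * b +
      Ns.+1 * ((2 * y + 11) * b + (2 * w + 6) * b) + 10 * b)) =
      Ni.+1 * b * ((2 * x + 23) + Ns.+1 * (2 * y + 2 * w + 17)) by ring.
  have -> (x y w : nat) : (2 * x + 2 * y + 2 * w + 40) * b * Ni.+1 * Ns.+1 =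
      Ni.+1 * b * (Ns.+1 * (2 * x + 23) + Ns.+1 * (2 * y + 2 * w + 17)) by ring.
  by rewrite leq_mul2l leq_add2r leq_pmull ?orbT.
- by move=> s1 [].
Qed.
End Machine.

(** * Tuples of variables as numbers in base n, and arithmetic expressions *)

Section Code.
Local Open Scope nat_scope.

Definition code (n : nat) (ds : seq nat) := foldr (fun d w => d + n * w) 0 ds.

Fixpoint decode (n a w : nat) : seq nat :=
  if a is a'.+1 then w %% n :: decode n a' (w %/ n) else [::].

Lemma decode_code n ds : all (ltn^~ n) ds -> decode n (size ds) (code n ds) = ds.
Proof.
elim: ds => //= d ds IH /andP[dn h].
rewrite addnC mulnC modnMDl modn_small // divnMDl; last by apply: leq_ltn_trans dn.
by rewrite divn_small // addn0 IH.
Qed.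

Lemma code_lt n ds : all (ltn^~ n) ds -> code n ds < n ^ size ds.
Proof.
elim: ds => //= d ds IH /andP[dn /IH h]; rewrite expnS; nia.
Qed.

Lemma code_inj n ds ds' : all (ltn^~ n) ds -> all (ltn^~ n) ds' ->
  size ds = size ds' -> code n ds = code n ds' -> ds = ds'.
Proof. by move=> h h' e ec; rewrite -(decode_code h) e ec decode_code. Qed.

(** A single loop counter runs over all pairs of constraints: its quotient and remainder by the
    number of constraints are the two positions. *)
Lemma sum_pairs (T : Type) (x0 : T) (I : seq T) (f : T -> T -> nat) :
  \sum_(g < size I * size I) f (nth x0 I (g %/ size I)) (nth x0 I (g %% size I))
  = \sum_(C <- I) \sum_(C' <- I) f C C'.
Proof.
rewrite -(big_mkord xpredT
  (fun g => f (nth x0 I (g %/ size I)) (nth x0 I (g %% size I)))).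
rewrite big_nat_mul (big_nth x0); apply: eq_big_nat => i /andP[_ ilt].
rewrite [RHS](big_nth x0) -{1}[i * size I]add0n big_addn mulSn addnK.
apply: eq_big_nat => j /andP[_ jlt].
have I0 : 0 < size I by apply: leq_ltn_trans jlt.
by rewrite addnC divnMDl // divn_small // addn0 modnMDl modn_small.
Qed.

Definition nE := Read 0 (Const 0).
Definition mE := Read 0 (Const 1).
Definition powE a := iter a (Bin Mul nE) (Const 1).
Definition modE e1 e2 := Bin Sub e1 (Bin Mul (Bin Div e1 e2) e2).
(** Subtraction is truncated: the sum of the two differences is the distance of the values, so 1
    minus it is the truth value of their equality. *)
Definition eqE e1 e2 := Bin Sub (Const 1) (Bin Add (Bin Sub e1 e2) (Bin Sub e2 e1)).
Definition codeE es := foldr (fun e w => Bin Add e (Bin Mul nE w)) (Const 0) es.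
Definition sumE es := foldr (Bin Add) (Const 0) es.
Definition notE e := Bin Sub (Const 1) e.

Lemma eval_mulE s e1 e2 : eval s (Bin Mul e1 e2) = eval s e1 * eval s e2.
Proof. by []. Qed.

Lemma eval_addE s e1 e2 : eval s (Bin Add e1 e2) = eval s e1 + eval s e2.
Proof. by []. Qed.

Lemma eval_subE s e1 e2 : eval s (Bin Sub e1 e2) = eval s e1 - eval s e2.
Proof. by []. Qed.

Lemma eval_powE s a : eval s (powE a) = s 0 0 ^ a.
Proof. by elim: a => //= a IH; rewrite expnS -IH. Qed.

Lemma eval_modE s e1 e2 : eval s (modE e1 e2) = eval s e1 %% eval s e2.
Proof. by rewrite /= {1}(divn_eq (eval s e1) (eval s e2)) addKn. Qed.

Lemma eval_eqE s e1 e2 : eval s (eqE e1 e2) = (eval s e1 == eval s e2).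
Proof. rewrite /=; case: eqP; lia. Qed.

Lemma eval_codeE s es : eval s (codeE es) = code (s 0 0) (map (eval s) es).
Proof. by elim: es => //= e es ->. Qed.

Lemma eval_sumE s es : eval s (sumE es) = sumn (map (eval s) es).
Proof. by elim: es => //= e es ->. Qed.

Lemma eval_notE s e (b : bool) : eval s e = b -> eval s (notE e) = ~~ b.
Proof. by move=> /= ->; case: b. Qed.

End Code.

(** * The certification program *)

Section Tests.
Local Open Scope nat_scope.
Variables (k : nat) (P : predicate k) (n : nat) (g : nat) (l : seq 'I_k).
Implicit Types (C : constraint P n) (I : instance P n).

(* [l] lists a set of coordinates, cut into two blocks [side true] and
   [side false] of equal length and an [odd_part] of length 0 or 1. *)
Definition half := (size l)./2.
Definition side (o : bool) := if o then take half l else take half (drop half l).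
Definition odd_part := drop half (drop half l).

Definition digits (r : seq 'I_k) C : seq nat := [seq nat_of_ord (C.2 i) | i <- r].
Definition bits (r : seq 'I_k) C : seq nat := [seq nat_of_bool (C.1 i) | i <- r].

Definition same (r : seq 'I_k) C C' := code n (digits r C) == code n (digits r C').
Definition negative C C' := odd (sumn (bits l C ++ bits l C')).
Definition vertex o C C' := code n (digits (side o) C ++ digits (side o) C').
Definition dim := n ^ (half + half).
(** The matrix is multiplied by this number before it is squared, which keeps the tables integral.
    The factor [dim] compensates the dimension lost in Cauchy-Schwarz, the others the bound wanted
    for the character sum. *)
Definition scale := g * g * (n ^ odd (size l) * dim).

Definition diagonal C C' := same odd_part C C' && same (side true ++ side false) C C'.
Definition linked C C' := same odd_part C C' && ~~ same (side true ++ side false) C C'.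

(** Both orientations of a pair are counted. This makes the matrix symmetric and doubles its
    quadratic form, whence the factor 1/2 in front of the form. *)
Definition hits C C' u v : nat :=
  (vertex true C C' == u) * (vertex false C C' == v) +
  (vertex false C C' == u) * (vertex true C C' == v).

(* Integers are handled as differences of naturals: in all the tables below,
   [false] is for the positive part and [true] for the negative part. *)
Definition diag0 I (b : bool) :=
  \sum_(C <- I) \sum_(C' <- I) diagonal C C' * (negative C C' == b).

Definition table0 I (b : bool) (i : nat) := \sum_(C <- I) \sum_(C' <- I)
  scale * (linked C C' * (negative C C' == b) * hits C C' (i %/ dim) (i %% dim)).

Definition square (h : bool -> nat -> nat) (b : bool) (i : nat) :=
  \sum_(j < dim) (h false (i %/ dim * dim + j) * h b (j * dim + i %% dim) +
                  h true (i %/ dim * dim + j) * h (~~ b) (j * dim + i %% dim)).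

Definition frobenius (h : bool -> nat -> nat) (b : bool) :=
  \sum_(i < dim * dim) (h false i * h b i + h true i * h (~~ b) i).

Lemma entry_le2 C C' b u v :
  linked C C' * (negative C C' == b) * hits C C' u v <= 2.
Proof.
rewrite /hits; case: linked; case: eqP => _ //.
by case: (vertex true C C' == u); case: (vertex false C C' == v);
   case: (vertex false C C' == u); case: (vertex true C C' == v).
Qed.

(** An equivalence is needed, and not mere existence: the loop of the program tests [2 ^ 2 ^ i]
    against [n] and must stop exactly at [i = r]. *)
Lemma rounds_subproof : {r | forall i, (n <= 2 ^ 2 ^ i) = (r <= i)}.
Proof.
have ex : exists r, n <= 2 ^ 2 ^ r.
  by exists n; do 2!apply: ltnW (leq_ltn_trans _ (ltn_expl _ _)) => //.
exists (ex_minn ex) => i; case: ex_minnP => r nr rmin.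
apply/idP/idP => [/rmin //|ri]; apply: leq_trans nr _.
by rewrite !leq_exp2l.
Qed.

(* The number of squarings, of order [log (log n)]. *)
Definition rounds := sval rounds_subproof.

(** Each test grants one half of the bound on the squared character sum. The negative parts stand on
    the right, since a difference of naturals would be truncated. *)
Definition passes I :=
  (2 * (g * g * n ^ odd (size l)) * diag0 I false <=
   size I * size I + 2 * (g * g * n ^ odd (size l)) * diag0 I true) &&
  (let h := iter rounds square (table0 I) in
   frobenius h false <= ((size I * size I) ^ 2 ^ rounds) ^ 2 + frobenius h true).

End Tests.

Section Program.
Local Open Scope nat_scope.
Variables (k : nat) (g : nat) (l : seq 'I_k).

(** The input has two header cells, then [2 * k] cells per constraint: its signs followed by its
    variables. *)
Definition fieldE c i := Read 0 (Bin Add (Const 2) (Bin Add (Bin Mul c (Const (2 * k))) (Const i))).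
Definition digitsE (r : seq 'I_k) c := [seq fieldE c (k + nat_of_ord i) | i <- r].
Definition bitsE (r : seq 'I_k) c := [seq fieldE c (nat_of_ord i) | i <- r].
Definition c1E := Bin Div (var gv) mE.
Definition c2E := modE (var gv) mE.
Definition sameE r := eqE (codeE (digitsE r c1E)) (codeE (digitsE r c2E)).
Definition signE (b : bool) := eqE (modE (sumE (bitsE l c1E ++ bitsE l c2E)) (Const 2)) (Const b).
Definition vertexE o := codeE (digitsE (side l o) c1E ++ digitsE (side l o) c2E).
Definition dimE := powE (half l + half l).
Definition ggE := Bin Mul (Const (g * g)) (powE (odd (size l))).
Definition scaleE := Bin Mul (Const (g * g)) (Bin Mul (powE (odd (size l))) dimE).
Definition rowE := Bin Div (var iv) dimE.
Definition colE := modE (var iv) dimE.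
Definition diagonalE b := Bin Mul
  (Bin Mul (sameE (odd_part l)) (sameE (side l true ++ side l false))) (signE b).
Definition hitsE := Bin Add
  (Bin Mul (eqE (vertexE true) rowE) (eqE (vertexE false) colE))
  (Bin Mul (eqE (vertexE false) rowE) (eqE (vertexE true) colE)).
Definition tableE b := Bin Mul scaleE (Bin Mul (Bin Mul
  (Bin Mul (sameE (odd_part l)) (notE (sameE (side l true ++ side l false))))
  (signE b)) hitsE).

Definition DA (b : bool) := 5 + b.
Definition HA (b : bool) := 7 + b.
Definition GA (b : bool) := 9 + b.
Definition FA (b : bool) := 11 + b.
Definition qv := 13.
Definition tv := 14.

Definition dotE i j b := Bin Add
  (Bin Mul (Read (HA false) i) (Read (HA b) j))
  (Bin Mul (Read (HA true) i) (Read (HA (~~ b)) j)).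
Definition squareE b := dotE (Bin Add (Bin Mul rowE dimE) (var gv))
                             (Bin Add (Bin Mul (var gv) dimE) colE) b.
Definition copyE b := Read (GA b) (var iv).
Definition frobeniusE b := dotE (var gv) (var gv) b.

Definition mmE := Bin Mul mE mE.
Definition ddE := Bin Mul dimE dimE.

Definition fail := Write 1 (Const 0) (Const 0).
Definition both (f : bool -> program) := Seq (f false) (f true).

(** The results go to [GA] first, since each part of the square reads both the positive and the
    negative part of the old table. *)
Definition squareP := Seq
  (both (fun b => Table (GA b) ddE dimE (squareE b)))
  (both (fun b => Table (HA b) ddE (Const 1) (copyE b))).

(** [qv] runs through the numbers [2 ^ 2 ^ i], so that no logarithm is computed, and [tv] raises the
    threshold to the same exponent as the matrix. *)
Definition loopP := While (Bin Sub nE (var qv))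
  (Seq (Seq (Write qv (Const 0) (Bin Mul (var qv) (var qv)))
            (Write tv (Const 0) (Bin Mul (var tv) (var tv)))) squareP).

Definition diagTestE := Bin Sub (Bin Mul (Bin Mul (Const 2) ggE) (var (DA false)))
  (Bin Add mmE (Bin Mul (Bin Mul (Const 2) ggE) (var (DA true)))).
Definition frobTestE := Bin Sub (var (FA false))
  (Bin Add (Bin Mul (var tv) (var tv)) (var (FA true))).

Definition diagP := Seq
  (both (fun b => Table (DA b) (Const 1) mmE (diagonalE b)))
  (If diagTestE fail Skip).

Definition tableP := Seq
  (both (fun b => Table (HA b) ddE mmE (tableE b)))
  (Seq (Write qv (Const 0) (Const 2)) (Write tv (Const 0) mmE)).

Definition frobP := Seq
  (both (fun b => Table (FA b) (Const 1) ddE (frobeniusE b)))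
  (If frobTestE fail Skip).

Definition testP := Seq (Seq diagP tableP) (Seq loopP frobP).

End Program.

(** * Values of the expressions on an encoded instance *)

Section Input.
Local Open Scope nat_scope.
Variables (k : nat) (P : predicate k) (n : nat) (g : nat) (l : seq 'I_k).
Implicit Types (C : constraint P n) (I : instance P n).

Lemma size_encode C : size (encode_constraint C) = 2 * k.
Proof. by rewrite size_cat size_map size_enum_ord size_map size_enum_ord mul2n addnn. Qed.

Lemma nth_flatten_block (T : Type) (x : T) (ss : seq (seq T)) d c j :
  all (fun s => size s == d) ss -> j < d ->
  nth x (flatten ss) (c * d + j) = nth x (nth [::] ss c) j.
Proof.
move=> + jd; elim: ss c => [|s ss IH] c /=; first by rewrite !nth_nil.
move=> /andP[/eqP sd h]; rewrite nth_cat sd; case: c => [|c] /=.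
  by rewrite mul0n add0n jd.
by rewrite mulSn -addnA ltnNge leq_addr /= addKn IH.
Qed.

Lemma nth_encode I c j : j < 2 * k -> c < size I ->
  forall C0, nth 0 (encode I) (2 + (c * (2 * k) + j)) =
             nth 0 (encode_constraint (nth C0 I c)) j.
Proof.
move=> jk cI C0; rewrite /encode /= nth_flatten_block //; last first.
  by apply/allP => _ /mapP[C _ ->]; rewrite size_encode.
by rewrite (nth_map C0).
Qed.

Lemma nth_encode_bit C (i : 'I_k) : nth 0 (encode_constraint C) i = C.1 i.
Proof.
rewrite nth_cat size_map size_enum_ord ltn_ord.
by rewrite (nth_map i) ?size_enum_ord // nth_ord_enum.
Qed.

Lemma nth_encode_digit C (i : 'I_k) : nth 0 (encode_constraint C) (k + i) = C.2 i.
Proof.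
rewrite nth_cat size_map size_enum_ord ltnNge leq_addr /= addKn.
by rewrite (nth_map i) ?size_enum_ord // nth_ord_enum.
Qed.

Variables (I : instance P n) (C0 : constraint P n) (s : memory) (j : nat).
Hypotheses (s0 : s 0 =1 nth 0 (encode I)) (sj : s gv 0 = j)
  (jlt : j < size I * size I).
Let C1 := nth C0 I (j %/ size I).
Let C2 := nth C0 I (j %% size I).

Lemma eval_nE : eval s nE = n. Proof. by rewrite /= s0. Qed.
Lemma eval_mE : eval s mE = size I. Proof. by rewrite /= s0. Qed.

Let m0 : 0 < size I. Proof. by case: (size I) jlt. Qed.

Lemma eval_c1E : eval s c1E = j %/ size I.
Proof. by rewrite -eval_mE -sj. Qed.
Lemma eval_c2E : eval s c2E = j %% size I.
Proof. by rewrite eval_modE eval_mE -sj. Qed.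

Lemma eval_fieldE c i : i < 2 * k -> eval s c < size I ->
  eval s (fieldE k c i) = nth 0 (encode_constraint (nth C0 I (eval s c))) i.
Proof. by move=> ik cI; rewrite -nth_encode // -s0. Qed.

Lemma eval_digitsE c r : eval s c < size I ->
  map (eval s) (digitsE r c) = digits r (nth C0 I (eval s c)).
Proof.
move=> cI; rewrite -map_comp; apply: eq_map => i; rewrite /comp eval_fieldE //.
  by rewrite nth_encode_digit.
by rewrite mul2n -addnn ltn_add2l.
Qed.

Lemma eval_bitsE c r : eval s c < size I ->
  map (eval s) (bitsE r c) = bits r (nth C0 I (eval s c)).
Proof.
move=> cI; rewrite -map_comp; apply: eq_map => i; rewrite /comp eval_fieldE //.
  by rewrite nth_encode_bit.
by rewrite (leq_trans (ltn_ord i)) // leq_pmull.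
Qed.

Let c1lt : eval s c1E < size I.
Proof. by rewrite eval_c1E ltn_divLR. Qed.
Let c2lt : eval s c2E < size I.
Proof. by rewrite eval_c2E ltn_mod. Qed.

Lemma eval_sameE r : eval s (sameE r) = same r C1 C2.
Proof.
rewrite eval_eqE !eval_codeE !eval_digitsE // eval_c1E eval_c2E.
by rewrite -[s 0 0]/(eval s nE) eval_nE.
Qed.

Lemma eval_signE b : eval s (signE l b) = (negative l C1 C2 == b).
Proof.
rewrite eval_eqE eval_modE eval_sumE map_cat !eval_bitsE // eval_c1E eval_c2E.
rewrite [eval s (Const 2)]/= [eval s (Const b)]/= modn2 -/(negative l C1 C2).
by case: negative; case: b.
Qed.

Lemma eval_vertexE o : eval s (vertexE l o) = vertex l o C1 C2.
Proof.
rewrite eval_codeE map_cat !eval_digitsE // eval_c1E eval_c2E.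
by rewrite -[s 0 0]/(eval s nE) eval_nE.
Qed.

Lemma eval_dimE : eval s (dimE l) = dim n l.
Proof. by rewrite eval_powE -[s 0 0]/(eval s nE) eval_nE. Qed.

Lemma eval_rowE i : s iv 0 = i -> eval s (rowE l) = i %/ dim n l.
Proof. by move=> si; rewrite -eval_dimE -si. Qed.

Lemma eval_colE i : s iv 0 = i -> eval s (colE l) = i %% dim n l.
Proof. by move=> si; rewrite eval_modE eval_dimE -si. Qed.

Lemma eval_ggE : eval s (ggE g l) = g * g * n ^ odd (size l).
Proof. by rewrite -eval_nE /= eval_powE. Qed.

Lemma eval_scaleE : eval s (scaleE g l) = scale n g l.
Proof. by rewrite /scale -eval_dimE -eval_nE /= !eval_powE. Qed.

Lemma eval_diagonalE b :
  eval s (diagonalE l b) = diagonal l C1 C2 * (negative l C1 C2 == b).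
Proof.
by rewrite /diagonalE !eval_mulE !eval_sameE eval_signE -mulnb.
Qed.

Lemma eval_tableE b i : s iv 0 = i -> eval s (tableE g l b) =
  scale n g l * (linked l C1 C2 * (negative l C1 C2 == b) *
    hits l C1 C2 (i %/ dim n l) (i %% dim n l)).
Proof.
move=> si.
rewrite /tableE eval_mulE eval_scaleE !eval_mulE (eval_notE (eval_sameE _)).
by rewrite eval_sameE eval_signE eval_addE !eval_mulE !eval_eqE
  (eval_rowE si) (eval_colE si) !eval_vertexE -mulnb.
Qed.

End Input.

(** * Time accounting *)

Section Budget.
Local Open Scope nat_scope.

Fixpoint size_of (c : program) : nat :=
  match c with
  | Skip => 1
  | Write _ i e => weight i + weight e
  | Seq c1 c2 => size_of c1 + size_of c2
  | If e c1 c2 => weight e + size_of c1 + size_of c2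
  | While e c => weight e + size_of c
  end.

(** Time is charged by the size of the text, in a unit [U] that the phases share. The factor 40
    covers the additive constant of [runs_table]. *)
Definition budget U c := 40 * size_of c * U.

Variables (b U : nat).
Hypotheses (b0 : 0 < b) (bU : b <= U).

Lemma runs_seqU c1 c2 s Q :
  runs c1 s (budget U c1) (fun s1 => runs c2 s1 (budget U c2) Q) ->
  runs (Seq c1 c2) s (budget U (Seq c1 c2)) Q.
Proof. by move=> /runs_seq; rewrite /budget /= mulnDr mulnDl. Qed.

Lemma runs_skipU s (Q : memory -> Prop) : Q s -> runs Skip s (budget U Skip) Q.
Proof. by move=> q; exists 1, s; split=> //; [exact: exec_skip|rewrite /budget /=; lia]. Qed.

Lemma runs_writeU a i e s (Q : memory -> Prop) : small b s ->
  Q (update s a (eval s i) (eval s e)) -> runs (Write a i e) s (budget U (Write a i e)) Q.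
Proof.
move=> sb q; apply: (runs_write b0 sb) => //; rewrite /budget [size_of _]/=; nia.
Qed.

Lemma runs_ifU e c1 c2 s (Q : memory -> Prop) : small b s ->
  (eval s e != 0 -> runs c1 s (budget U c1) Q) ->
  (eval s e = 0 -> runs c2 s (budget U c2) Q) ->
  runs (If e c1 c2) s (budget U (If e c1 c2)) Q.
Proof.
move=> sb h1 h2.
have : runs (if eval s e != 0 then c1 else c2) s (budget U c1 + budget U c2) Q.
  have [e0|e0] := eqVneq (eval s e) 0.
    by apply: runs_weak (h2 e0) _ (fun _ => id); rewrite leq_addl.
  by apply: runs_weak (h1 e0) _ (fun _ => id); rewrite leq_addr.
move=> /(runs_if b0 sb) h; apply: runs_weak h _ (fun _ => id).
rewrite /budget [size_of (If _ _ _)]/=; nia.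
Qed.

Lemma runs_tableU (A : nat) Bi Bs e s Ni Ns (F : nat -> nat -> nat) : small b s ->
  Ni < 2 ^ b -> Ns < 2 ^ b -> b * Ni.+1 * Ns.+1 <= U ->
  (forall i, i < Ni -> \sum_(g < Ns) F i g < 2 ^ b) ->
  A \notin [:: iv; gv; av] ->
  let D : seq nat := [:: A; iv; gv; av] in
  (forall s', agree D s s' -> eval s' Bi = Ni) ->
  (forall s', agree D s s' -> eval s' Bs = Ns) ->
  (forall s' i g, agree D s s' -> s' iv 0 = i -> s' gv 0 = g ->
     i < Ni -> g < Ns -> eval s' e = F i g) ->
  runs (Table A Bi Bs e) s (budget U (Table A Bi Bs e))
    (fun s' => [/\ small b s', agree D s s' &
       forall i, i < Ni -> s' A i = \sum_(g < Ns) F i g]).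
Proof.
move=> sb Nib Nsb NU Fb AD D h1 h2 h3.
apply: runs_weak (runs_table b0 sb Nib Nsb Fb AD h1 h2 h3) _ (fun _ => id).
rewrite -2!mulnA [b * _]mulnA /budget leq_mul //.
rewrite /= /bitlen trunc_log0 trunc_log1; lia.
Qed.

Lemma runs_whileU N (Inv : nat -> memory -> Prop) e c s :
  (forall i s, i <= N -> Inv i s -> small b s) ->
  (forall i s, i < N -> Inv i s -> eval s e <> 0) ->
  (forall i s, i < N -> Inv i s -> runs c s (budget U c) (Inv i.+1)) ->
  (forall s, Inv N s -> eval s e = 0) ->
  Inv 0 s ->
  runs (While e c) s (budget (U * N.+1) (While e c)) (Inv N).
Proof.
move=> h1 h2 h3 h4 h5; apply: runs_weak (runs_while b0 h1 h2 h3 h4 h5) _ (fun _ => id).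
rewrite /budget mulnA [_ * N.+1]mulnC leq_mul2l /= mulnDr mulnDl leq_add2r.
nia.
Qed.

End Budget.

Lemma budgetW U U' c : (U <= U')%N -> (budget U c <= budget U' c)%N.
Proof. by move=> h; rewrite leq_mul2l h orbT. Qed.

Lemma index_lt d i j : (i < d -> j < d -> i * d + j < d * d)%N.
Proof. by nia. Qed.

(** The extra factor [X] makes the induction close: if all [h * X <= E], an entry of the square
    times [X ^ 2] is at most [2 * dim * E ^ 2], and [2 * dim <= X] takes back one factor [X]. *)
Lemma iter_square_bound k n (l : seq 'I_k) (h : bool -> nat -> nat) X r :
  (forall b i, i < dim n l * dim n l -> h b i <= X)%N -> (2 * dim n l <= X)%N ->
  forall b i, (i < dim n l * dim n l)%N ->
    (iter r (square n l) h b i * X <= X ^ 2 ^ r.+1)%N.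
Proof.
move=> hX dX.
have sq (h' : bool -> nat -> nat) E : (forall b i, i < dim n l * dim n l -> h' b i * X <= E)%N ->
   (forall b i, i < dim n l * dim n l -> square n l h' b i * X <= E * E)%N.
  move=> h'E b i ilt.
  have d0 : (0 < dim n l)%N by case: (dim n l) ilt.
  have il : (i %/ dim n l < dim n l)%N by rewrite ltn_divLR.
  have ir : (i %% dim n l < dim n l)%N by rewrite ltn_mod.
  have : (square n l h' b i * (X * X) <= dim n l * (2 * (E * E)))%N.
    rewrite /square big_distrl /=.
    apply: (@leq_trans (\sum_(j < dim n l) 2 * (E * E))%N); last first.
      by rewrite sum_nat_const card_ord.
    apply: leq_sum => j _.
    have H b1 b2 : (h' b1 (i %/ dim n l * dim n l + j) * h' b2 (j * dim n l + i %% dim n l)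
        * (X * X) <= E * E)%N.
      have jd := ltn_ord j.
      by rewrite mulnACA leq_mul // h'E //; apply: index_lt.
    by have := H false b; have := H true (~~ b); rewrite mulnDl; lia.
  move=> sX.
  have X0 : (0 < X)%N by apply: leq_trans dX; rewrite muln_gt0.
  rewrite -(leq_pmul2r X0) -mulnA (leq_trans sX) //.
  by rewrite mulnA [(dim n l * 2)%N]mulnC [leqLHS]mulnC leq_mul2l dX orbT.
elim: r => [|r IH] b i ilt; first by rewrite /= expn1 expnS expn1 leq_mul2r hX ?orbT.
by rewrite iterS expnS mul2n -addnn expnD; apply: sq.
Qed.

(** * Running the phases of one test, with bounds on all values *)

Section Phases.
Local Open Scope nat_scope.
Variables (k : nat) (P : predicate k) (n : nat) (g : nat) (l : seq 'I_k).
Variables (I : instance P n) (X : nat).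
Let m := size I.
Let d := dim n l.
Let r := rounds n.
Hypotheses (X1 : 1 < X) (nX : n <= X) (dX : 2 * d * d <= X) (mX : m * m <= X)
  (tX : 2 * scale n g l * (m * m) <= X).
(** Every value will be at most [X ^ (2 * 2 ^ r.+1)]. Taking [X] for the bit length of [X] is
    generous, but [X] is polynomial in the input for a fixed arity. *)
Let B := X * (2 * 2 ^ r.+1).
Let U := B * X.+1 * X.+1.

Let L0 : 0 < 2 * 2 ^ r.+1.
Proof. by rewrite muln_gt0 expn_gt0. Qed.

Let B0 : 0 < B.
Proof. by rewrite muln_gt0 L0 (ltnW X1). Qed.

Let ltB v : v <= X ^ (2 * 2 ^ r.+1) -> v < 2 ^ B.
Proof.
move=> vX; apply: leq_ltn_trans vX _.
rewrite /B (expnM 2 X) (ltn_exp2r _ _ L0); exact: ltn_expl.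
Qed.

Lemma le_expX v : v <= X -> v <= X ^ (2 * 2 ^ r.+1).
Proof.
by move=> vX; apply: (leq_trans vX); rewrite -[X in X <= _]expn1 (leq_exp2l _ _ X1) L0.
Qed.

Let leX v : v <= X -> v < 2 ^ B.
Proof. by move=> vX; apply/ltB/le_expX. Qed.

Let BU : B <= U.
Proof. by rewrite /U -mulnA leq_pmulr. Qed.

Let U_le u v : u <= X -> v <= X -> B * u.+1 * v.+1 <= U.
Proof. by move=> uX vX; rewrite !leq_mul. Qed.

Let ddX : d * d <= X. Proof. by move: dX; nia. Qed.
Let d1X : d <= X. Proof. by move: dX; nia. Qed.

(** [v] is the answer so far: a passed test keeps it and a failed one sets it to 0, so the outcomes
    of the tests multiply. *)
Definition ready v s := [/\ small B s, s 0 =1 nth 0 (encode I) & s 1 0 = v].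

Lemma readyW (D : seq nat) v s s' : 0 \notin D -> 1 \notin D -> ready v s ->
  small B s' -> agree D s s' -> ready v s'.
Proof.
move=> D0 D1 [sb s0 s1] sb' ag; split=> // [i|]; last by rewrite ag.
by rewrite ag.
Qed.

Definition loaded s := s 0 =1 nth 0 (encode I).

Lemma runs_tableB (A : nat) Bi Bs e s v Ni Ns (F : nat -> nat -> nat) :
  4 < A -> ready v s -> Ni <= X -> Ns <= X ->
  (forall i, i < Ni -> \sum_(j < Ns) F i j <= X ^ (2 * 2 ^ r.+1)) ->
  (forall s', loaded s' -> eval s' Bi = Ni) ->
  (forall s', loaded s' -> eval s' Bs = Ns) ->
  (forall s' i j, loaded s' -> agree [:: A; iv; gv; av] s s' ->
     s' iv 0 = i -> s' gv 0 = j -> i < Ni -> j < Ns -> eval s' e = F i j) ->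
  runs (Table A Bi Bs e) s (budget U (Table A Bi Bs e))
    (fun s' => [/\ ready v s', agree [:: A; iv; gv; av] s s' &
       forall i, i < Ni -> s' A i = \sum_(j < Ns) F i j]).
Proof.
move=> A4 rs NiX NsX FB h1 h2 h3.
have [sb s0 s1] := rs.
have A01 : (0 \notin [:: A; iv; gv; av]) && (1 \notin [:: A; iv; gv; av]).
  by rewrite !inE /iv /gv /av; lia.
have ld s' : agree [:: A; iv; gv; av] s s' -> loaded s'.
  by move=> ag i; rewrite ag ?s0 //; case/andP: A01.
apply: runs_weak (runs_tableU B0 BU (F := F) sb (leX NiX) (leX NsX) (U_le NiX NsX)
  _ _ _ _ _) (leqnn _) _.
- by move=> i iN; apply/ltB/FB.
- by rewrite !inE /iv /gv /av; lia.
- by move=> s' /ld; apply: h1.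
- by move=> s' /ld; apply: h2.
- by move=> s' i j ag; apply: h3 => //; exact: ld.
- move=> s' [sb' ag As]; split=> //.
  by case/andP: A01 => *; apply: readyW ag.
Qed.

(** [nth] wants a default constraint, and there may be none at all when [n = 0]; hence the match. *)
Lemma sum_pairs_of (f : constraint P n -> constraint P n -> nat) :
  \sum_(j < m * m) (if I is C0 :: _ then f (nth C0 I (j %/ m)) (nth C0 I (j %% m)) else 0)
  = \sum_(C <- I) \sum_(C' <- I) f C C'.
Proof.
rewrite /m; case: I => [|C0 I']; first by rewrite big_ord0 big_nil.
exact: sum_pairs.
Qed.

Lemma sum_pairs_le (f : constraint P n -> constraint P n -> nat) y :
  (forall C C', f C C' <= y) -> \sum_(C <- I) \sum_(C' <- I) f C C' <= y * (m * m).
Proof.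
move=> fy; apply: (@leq_trans (\sum_(C <- I) \sum_(C' <- I) y)).
  by do 2!(apply: leq_sum => ? _).
by rewrite !big_const_seq !count_predT !iter_addn_0 mulnA.
Qed.

Lemma runs_pair_table (A : nat) Bi e s v Ni (f : nat -> constraint P n -> constraint P n -> nat) y :
  4 < A -> ready v s -> Ni <= X -> (forall i C C', f i C C' <= y) -> y * (m * m) <= X ->
  (forall s', loaded s' -> eval s' Bi = Ni) ->
  (forall s' i j C0, loaded s' -> s' iv 0 = i -> s' gv 0 = j -> j < m * m ->
     eval s' e = f i (nth C0 I (j %/ m)) (nth C0 I (j %% m))) ->
  runs (Table A Bi mmE e) s (budget U (Table A Bi mmE e))
    (fun s' => [/\ ready v s', agree [:: A; iv; gv; av] s s' &
       forall i, i < Ni -> s' A i = \sum_(C <- I) \sum_(C' <- I) f i C C']).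
Proof.
move=> A4 rs NiX fy yX h1 h2.
apply: runs_weak (runs_tableB (Ns := m * m) (F := fun i j =>
  if I is C0 :: _ then f i (nth C0 I (j %/ m)) (nth C0 I (j %% m)) else 0)
  A4 rs NiX mX _ h1 _ _) (leqnn _) _.
- move=> i _; rewrite sum_pairs_of.
  exact: leq_trans (sum_pairs_le (fy i)) (le_expX yX).
- by move=> s' ls; rewrite eval_mulE !(eval_mE ls).
- move=> s' i j ls _ si sj _ jm.
  have [I0|[C0 [I' e0]]] : I = [::] \/ exists C0 I', I = C0 :: I'.
  + by case: (I) => [|C0 I']; [left|right; exists C0, I'].
  + by move: jm; rewrite /m I0.
  + by rewrite (h2 _ _ _ C0 ls si sj jm) e0.
- by move=> s' [rs' ag As]; split=> // i /As ->; rewrite sum_pairs_of.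
Qed.

Lemma runs_fail e s v (c : bool) : ready v s -> (eval s e == 0) = c ->
  runs (If e fail Skip) s (budget U (If e fail Skip)) (ready (v * c)).
Proof.
move=> [sb s0 s1] ec; apply: (runs_ifU B0 BU) => // [e0|e0].
  apply: (runs_writeU B0 BU) => //; rewrite -ec (negbTE e0) muln0.
  by split; [apply: small_update => //; exact: leX|move=> i; rewrite update_out|].
by apply: (runs_skipU B0 BU); rewrite -ec e0 eqxx muln1.
Qed.

Definition diag_ok := 2 * (g * g * n ^ odd (size l)) * diag0 l I false <=
   m * m + 2 * (g * g * n ^ odd (size l)) * diag0 l I true.

Lemma runs_diag s v : ready v s ->
  runs (diagP g l) s (budget U (diagP g l)) (ready (v * diag_ok)).
Proof.
move=> rs; apply: runs_seqU => //; apply: runs_seqU => //.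
have H b s1 : ready v s1 ->
    runs (Table (DA b) (Const 1) mmE (diagonalE l b)) s1
      (budget U (Table (DA b) (Const 1) mmE (diagonalE l b)))
      (fun s' => [/\ ready v s', agree [:: DA b; iv; gv; av] s1 s' &
         forall i, i < 1 -> s' (DA b) i = diag0 l I b]).
  move=> rs1; apply: (runs_pair_table (Ni := 1)
    (f := fun _ C C' => diagonal l C C' * (negative l C C' == b)) (y := 1)) => //.
  - exact: ltnW.
  - by move=> _ C C'; case: diagonal; case: eqP.
  - by rewrite mul1n.
  - by move=> s' i j C0 ls _ sj jm; apply: eval_diagonalE.
apply: runs_weak (H false _ rs) (leqnn _) _ => s1 [rs1 _ D1].
apply: runs_weak (H true _ rs1) (leqnn _) _ => s2 [rs2 ag D2].
apply: runs_fail => //.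
have [_ s0 _] := rs2.
have -> : eval s2 (diagTestE g l) = 2 * eval s2 (ggE g l) * s2 (DA false) 0 -
  (eval s2 mE * eval s2 mE + 2 * eval s2 (ggE g l) * s2 (DA true) 0) by [].
by rewrite (eval_ggE _ _ s0) (eval_mE s0) subn_eq0 D2 // ag // D1.
Qed.

Definition holds_table (h : bool -> nat -> nat) (s : memory) :=
  forall b i, i < d * d -> s (HA b) i = h b i.

Lemma runs_init s v : ready v s ->
  runs (tableP g l) s (budget U (tableP g l))
    (fun s' => [/\ ready v s', holds_table (table0 g l I) s', s' qv 0 = 2 &
       s' tv 0 = m * m]).
Proof.
move=> rs; apply: runs_seqU => //; apply: runs_seqU => //.
have H b s1 : ready v s1 ->
    runs (Table (HA b) (ddE l) mmE (tableE g l b)) s1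
      (budget U (Table (HA b) (ddE l) mmE (tableE g l b)))
      (fun s' => [/\ ready v s', agree [:: HA b; iv; gv; av] s1 s' &
         forall i, i < d * d -> s' (HA b) i = table0 g l I b i]).
  move=> rs1; apply: (runs_pair_table (Ni := d * d) (y := scale n g l * 2)
    (f := fun i C C' => scale n g l * (linked l C C' * (negative l C C' == b) *
       hits l C C' (i %/ d) (i %% d)))) => //.
  - by move=> i C C'; rewrite leq_mul2l entry_le2 orbT.
  - by rewrite [scale _ _ _ * 2]mulnC.
  - by move=> s' ls; rewrite eval_mulE !(eval_dimE _ ls).
  - by move=> s' i j C0 ls si sj jm; apply: eval_tableE.
apply: runs_weak (H false _ rs) (leqnn _) _ => s1 [rs1 _ D1].
apply: runs_weak (H true _ rs1) (leqnn _) _ => s2 [rs2 ag D2].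
apply: runs_seqU => //; have [sb s0 s1'] := rs2.
apply: (runs_writeU B0 BU) => //; apply: (runs_writeU B0 BU) => //.
  by apply: small_update => //; exact: leX.
have mE2 s' : loaded s' -> eval s' mmE = m * m.
  by move=> ls; rewrite eval_mulE !(eval_mE ls).
rewrite mE2 //; split=> //.
  split=> //; apply: small_update; last exact: leX.
  by apply: small_update => //; exact: leX.
by case=> i id; [rewrite -(D2 _ id)|rewrite -(D1 _ id) -ag].
Qed.

Let tabler i := iter i (square n l) (table0 g l I).

Lemma table0_le b i : table0 g l I b i <= X.
Proof.
apply: leq_trans tX; rewrite [2 * _]mulnC; apply: sum_pairs_le => C C'.
by rewrite leq_mul2l entry_le2 orbT.
Qed.

Let d2X : 2 * d <= X. Proof. by move: dX; nia. Qed.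

Lemma tabler_le i b j : j < d * d -> tabler i b j * X <= X ^ 2 ^ i.+1.
Proof.
by move=> jd; apply: iter_square_bound => // b' i' _; exact: table0_le.
Qed.

Lemma expX_le i : i <= r -> X ^ 2 ^ i.+1 <= X ^ (2 * 2 ^ r.+1).
Proof.
move=> ir; rewrite leq_exp2l //; apply: (@leq_trans (2 ^ r.+1)).
  by rewrite leq_exp2l.
by rewrite leq_pmull.
Qed.

(** [N] will be the number of terms: [d] for an entry of the square, [d * d] for the Frobenius norm.
    The slack [X ^ 2] from two uses of [tabler_le] absorbs [2 * N]. *)
Lemma dot_le i b j j' (N : nat) : i <= r -> j < d * d -> j' < d * d -> N <= d * d ->
  N * (tabler i false j * tabler i b j' + tabler i true j * tabler i (~~ b) j')
    <= X ^ (2 * 2 ^ i.+1).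
Proof.
move=> ir jd jd' Nd.
have := leq_mul (tabler_le i false jd) (tabler_le i b jd').
have := leq_mul (tabler_le i true jd) (tabler_le i (~~ b) jd').
rewrite mulnACA [in X in _ -> X -> _]mulnACA -!expnD addnn -mul2n => h1 h2.
set a := _ + _; have : a * (X * X) <= 2 * X ^ (2 * 2 ^ i.+1).
  by rewrite mul2n -addnn mulnDl leq_add.
set E := X ^ _ => h.
have N2 : N * 2 <= X by move: dX; nia.
suff : N * a * (X * X) <= E * (X * X).
  by rewrite leq_pmul2r // muln_gt0 (ltnW X1).
rewrite -mulnA (leq_trans (leq_mul (leqnn N) h)) // mulnA.
rewrite [E * _]mulnC leq_mul2r (leq_trans N2) ?orbT // leq_pmulr //.
exact: ltnW.
Qed.

Lemma sum_le_mean (F : nat -> nat) N E : (forall j, j < N -> N * F j <= E) ->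
  \sum_(j < N) F j <= E.
Proof.
case: N => [|N] h; first by rewrite big_ord0.
rewrite -(leq_pmul2l (ltn0Sn N)) big_distrr /=.
apply: (@leq_trans (\sum_(j < N.+1) E)); first by apply: leq_sum => j _; exact: h.
by rewrite sum_nat_const card_ord.
Qed.

Lemma eval_dotE s h i j b : holds_table h s -> eval s i < d * d -> eval s j < d * d ->
  eval s (dotE i j b) = h false (eval s i) * h b (eval s j) +
                        h true (eval s i) * h (~~ b) (eval s j).
Proof. by move=> H ilt jlt; rewrite /= !H. Qed.

Lemma runs_square i s v : i < r -> ready v s -> holds_table (tabler i) s ->
  runs (squareP l) s (budget U (squareP l))
    (fun s' => [/\ ready v s', holds_table (tabler i.+1) s', s' qv 0 = s qv 0 &
       s' tv 0 = s tv 0]).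
Proof.
move=> ir rs Hs; apply: runs_seqU => //; apply: runs_seqU => //.
have H b s1 : ready v s1 -> holds_table (tabler i) s1 ->
    runs (Table (GA b) (ddE l) (dimE l) (squareE l b)) s1
      (budget U (Table (GA b) (ddE l) (dimE l) (squareE l b)))
      (fun s' => [/\ ready v s', agree [:: GA b; iv; gv; av] s1 s' &
         forall j, j < d * d -> s' (GA b) j = tabler i.+1 b j]).
  move=> rs1 H1; apply: (runs_tableB (Ni := d * d) (Ns := d) (F := fun i' j =>
    tabler i false (i' %/ d * d + j) * tabler i b (j * d + i' %% d) +
    tabler i true (i' %/ d * d + j) * tabler i (~~ b) (j * d + i' %% d))) => //.
  - move=> i' i'd.
    have d0 : 0 < d by case: d i'd.
    have il : i' %/ d < d by rewrite ltn_divLR.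
    have ilr : i' %% d < d by rewrite ltn_mod.
    apply: (@leq_trans (X ^ (2 * 2 ^ i.+1))); last first.
      by rewrite leq_exp2l // leq_mul2l leq_exp2l // ltnW.
    apply: (sum_le_mean (F := fun j =>
      tabler i false (i' %/ d * d + j) * tabler i b (j * d + i' %% d) +
      tabler i true (i' %/ d * d + j) * tabler i (~~ b) (j * d + i' %% d))) => j jd.
    apply: dot_le => //.
    + exact: ltnW.
    + exact: index_lt.
    + exact: index_lt.
    + by rewrite leq_pmulr.
  - by move=> s' ls; rewrite eval_mulE !(eval_dimE _ ls).
  - by move=> s' ls; rewrite (eval_dimE _ ls).
  - move=> s' i' j ls ag si sj i'd jd.
    have d0 : 0 < d by case: d i'd.
    have il : i' %/ d < d by rewrite ltn_divLR.
    have ilr : i' %% d < d by rewrite ltn_mod.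
    have hr : eval s' (Bin Add (Bin Mul (rowE l) (dimE l)) (var gv)) = i' %/ d * d + j.
      by rewrite eval_addE eval_mulE (eval_rowE _ ls si) (eval_dimE _ ls) -sj.
    have hc : eval s' (Bin Add (Bin Mul (var gv) (dimE l)) (colE l)) = j * d + i' %% d.
      by rewrite eval_addE eval_mulE (eval_colE _ ls si) (eval_dimE _ ls) -sj.
    rewrite /squareE (eval_dotE (h := tabler i)) ?hr ?hc ?index_lt //.
    by move=> b' j' j'd; rewrite ag ?H1 //; case: (b) (b') => -[].
apply: runs_weak (H false _ rs Hs) (leqnn _) _ => s1 [rs1 ag1 D1].
have H1 : holds_table (tabler i) s1 by move=> b j jd; rewrite ag1 ?Hs //; case: b.
apply: runs_weak (H true _ rs1 H1) (leqnn _) _ => s2 [rs2 ag2 D2].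
apply: runs_seqU => //.
have C b s' : ready v s' -> (forall j, j < d * d -> s' (GA b) j = tabler i.+1 b j) ->
    runs (Table (HA b) (ddE l) (Const 1) (copyE b)) s'
      (budget U (Table (HA b) (ddE l) (Const 1) (copyE b)))
      (fun s'' => [/\ ready v s'', agree [:: HA b; iv; gv; av] s' s'' &
         forall j, j < d * d -> s'' (HA b) j = tabler i.+1 b j]).
  move=> rs' G'.
  apply: runs_weak (runs_tableB (Ni := d * d) (Ns := 1)
    (F := fun j _ => tabler i.+1 b j) _ rs' ddX (ltnW X1) _ _ _ _) (leqnn _) _ => //.
  - move=> j jd; rewrite big_ord1; apply: leq_trans (expX_le ir).
    apply: leq_trans (tabler_le i.+1 b jd); exact: leq_pmulr (ltnW X1).
  - by move=> s'' ls; rewrite eval_mulE !(eval_dimE _ ls).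
  - by move=> s'' j _ ls ag sj _ jd _; rewrite /= sj ag ?G' //; case: (b).
  - by move=> s'' [rs'' ag D]; split=> // j jd; rewrite D // big_ord1.
have G1 j : j < d * d -> s2 (GA false) j = tabler i.+1 false j.
  by move=> jd; rewrite ag2 ?D1.
apply: runs_weak (C false _ rs2 G1) (leqnn _) _ => s3 [rs3 ag3 D3].
have G2 j : j < d * d -> s3 (GA true) j = tabler i.+1 true j.
  by move=> jd; rewrite ag3 ?D2.
apply: runs_weak (C true _ rs3 G2) (leqnn _) _ => s4 [rs4 ag4 D4].
split=> //.
- by case=> j jd; [rewrite D4|rewrite ag4 ?D3].
- by rewrite ag4 // ag3 // ag2 // ag1.
- by rewrite ag4 // ag3 // ag2 // ag1.
Qed.

Lemma rounds_le i : (n <= 2 ^ 2 ^ i) = (r <= i).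
Proof. exact: (svalP (rounds_subproof n)). Qed.

Lemma rounds_small : r <= X.
Proof.
rewrite -rounds_le; apply: leq_trans nX _.
by do 2!apply: ltnW (leq_ltn_trans _ (ltn_expl _ _)) => //.
Qed.

Let V := U * X.+1.

Lemma runs_loop s v : ready v s -> holds_table (table0 g l I) s -> s qv 0 = 2 ->
    s tv 0 = m * m ->
  runs (loopP l) s (budget V (loopP l))
    (fun s' => [/\ ready v s', holds_table (tabler r) s' &
       s' tv 0 = (m * m) ^ 2 ^ r]).
Proof.
move=> rs Hs sq st.
pose Inv i s' := [/\ ready v s', holds_table (tabler i) s', s' qv 0 = 2 ^ 2 ^ i &
  s' tv 0 = (m * m) ^ 2 ^ i].
have lE s' i : Inv i s' -> eval s' (Bin Sub nE (var qv)) = n - 2 ^ 2 ^ i.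
  by move=> [[_ ls _] _ sq' _]; rewrite eval_subE (eval_nE ls) -sq'.
have powB y i : y <= X -> i <= r -> y ^ 2 ^ i < 2 ^ B.
  move=> yX ir; apply: ltB; apply: leq_trans (expX_le ir).
  apply: (@leq_trans (X ^ 2 ^ i)); first by rewrite leq_exp2r // expn_gt0.
  by rewrite !leq_exp2l.
apply: (@runs_weak _ _ (budget (U * r.+1) (loopP l)) _ (Inv r)); first last.
- by move=> s' [].
- by apply: budgetW; rewrite leq_mul2l ltnS rounds_small orbT.
apply: (runs_whileU B0 BU) => //.
- by move=> i s' _ [[]].
- by move=> i s' ir /lE ->; apply/eqP; rewrite subn_eq0 rounds_le -ltnNge.
- move=> i s' ir [rs' Hs' sq' st'].
  apply: runs_seqU => //; apply: runs_seqU => //.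
  have [sb ls s1] := rs'.
  have pow2 y : y ^ 2 ^ i * y ^ 2 ^ i = y ^ 2 ^ i.+1.
    by rewrite -expnD addnn -mul2n -expnS.
  apply: (runs_writeU B0 BU) => //; apply: (runs_writeU B0 BU) => //.
    apply: small_update => //; rewrite eval_mulE /= sq' pow2.
    exact: powB.
  set s2 := update _ _ _ _.
  have e1 : s2 qv 0 = 2 ^ 2 ^ i.+1 by rewrite /s2 /= /update /= sq' pow2.
  have e2 : s2 tv 0 = (m * m) ^ 2 ^ i.+1 by rewrite /s2 /= /update /= st' pow2.
  have rs2 : ready v s2.
    split=> //.
    apply: small_update; last by rewrite eval_mulE /= /update /= st' pow2 powB.
    by apply: small_update => //; rewrite eval_mulE /= sq' pow2 powB.
  have Hs2 : holds_table (tabler i) s2.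
    by move=> b j jd; rewrite -(Hs' b j jd) /s2 !update_out //; case: (b).
  apply: runs_weak (runs_square ir rs2 Hs2) (leqnn _) _ => s3 [rs3 Hs3 q3 t3].
  by split=> //; rewrite ?q3 ?t3.
- by move=> s' /lE ->; apply/eqP; rewrite subn_eq0 rounds_le.
Qed.

Definition frob_ok := frobenius n l (tabler r) false <=
  ((m * m) ^ 2 ^ r) ^ 2 + frobenius n l (tabler r) true.

Lemma runs_frob s v : ready v s -> holds_table (tabler r) s ->
    s tv 0 = (m * m) ^ 2 ^ r ->
  runs (frobP l) s (budget U (frobP l)) (ready (v * frob_ok)).
Proof.
move=> rs Hs st; apply: runs_seqU => //; apply: runs_seqU => //.
have H b s1 : ready v s1 -> holds_table (tabler r) s1 ->
    runs (Table (FA b) (Const 1) (ddE l) (frobeniusE b)) s1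
      (budget U (Table (FA b) (Const 1) (ddE l) (frobeniusE b)))
      (fun s' => [/\ ready v s', agree [:: FA b; iv; gv; av] s1 s' &
         forall j, j < 1 -> s' (FA b) j = frobenius n l (tabler r) b]).
  move=> rs1 H1; apply: (runs_tableB (Ni := 1) (Ns := d * d) (F := fun _ j =>
    tabler r false j * tabler r b j + tabler r true j * tabler r (~~ b) j)) => //.
  - exact: ltnW.
  - move=> _ _; apply: (sum_le_mean (F := fun j =>
      tabler r false j * tabler r b j + tabler r true j * tabler r (~~ b) j)) => j jd.
    exact: dot_le.
  - by move=> s' ls; rewrite eval_mulE !(eval_dimE _ ls).
  - move=> s' _ j ls ag _ sj _ jd.
    have ej : eval s' (var gv) = j by [].
    rewrite (eval_dotE (h := tabler r)) ?ej //.
    by move=> b' j' j'd; rewrite ag ?H1 //; case: (b) (b') => -[].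
apply: runs_weak (H false _ rs Hs) (leqnn _) _ => s1 [rs1 ag1 D1].
have H1 : holds_table (tabler r) s1 by move=> b j jd; rewrite ag1 ?Hs //; case: b.
apply: runs_weak (H true _ rs1 H1) (leqnn _) _ => s2 [rs2 ag2 D2].
apply: runs_fail => //.
rewrite eval_subE subn_eq0 eval_addE eval_mulE /= D2 // [s2 (FA false) 0]ag2 // D1 //.
by rewrite /frob_ok ag2 // ag1 // st -mulnn.
Qed.

Lemma runs_test s v : ready v s ->
  runs (testP g l) s (budget V (testP g l)) (ready (v * passes g l I)).
Proof.
move=> rs; have UV : U <= V by rewrite leq_pmulr.
have BV : B <= V by exact: leq_trans UV.
have W c s' Q : runs c s' (budget U c) Q -> runs c s' (budget V c) Q.
  by move=> h; apply: runs_weak h (budgetW _ UV) (fun _ => id).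
apply: runs_seqU => //; apply: runs_seqU => //.
apply/W; apply: runs_weak (runs_diag rs) (leqnn _) _ => s1 rs1.
apply/W; apply: runs_weak (runs_init rs1) (leqnn _) _ => s2 [rs2 H2 q2 t2].
apply: runs_seqU => //.
apply: runs_weak (runs_loop rs2 H2 q2 t2) (leqnn _) _ => s3 [rs3 H3 t3].
apply/W; apply: runs_weak (runs_frob rs3 H3 t3) (leqnn _) _ => s4.
by rewrite -mulnA mulnb.
Qed.

End Phases.

(** * The whole program and its polynomial running time *)

Section Certify.
Local Open Scope nat_scope.
Variables (k : nat) (P : predicate k) (g : nat).

Definition certifyP (ls : seq (seq 'I_k)) :=
  Seq (Write 1 (Const 0) (Const 1))
      (foldr (fun l c => Seq (testP g l) c) Skip ls).

Definition base y := y + (g * g + 2).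
(** With Z for the base, the squared dimension is at most Z^(2k), and the scale times the squared
    number of constraints is at most Z^(k + 4); the exponent covers both. *)
Definition value_bound y := 2 * base y ^ (2 * k + 4).
Definition bit_bound y := value_bound y * (8 * base y).
Definition time_bound y :=
  bit_bound y * (value_bound y + 1) * (value_bound y + 1) * (value_bound y + 1).

(** For r = [rounds n] > 0, minimality gives 2^(2^(r - 1)) < n, of which only 2^(r - 1) < n is kept:
    a linear bound suffices for polynomial time. *)
Lemma rounds_pow n : 2 ^ rounds n <= 2 * n + 1.
Proof.
case e: (rounds n) => [|r]; first by rewrite addn1.
have : ~~ (n <= 2 ^ 2 ^ r) by rewrite rounds_le e ltnn.
rewrite -ltnNge => /(ltn_trans (ltn_expl (2 ^ r) (isT : 1 < 2))) /ltnW h.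
by rewrite expnS addn1 ltnW // ltnS leq_mul2l.
Qed.

Variables (n : nat) (I : instance P n).
Let m := size I.
Let X := value_bound (n + m).
Let Z := base (n + m).
Let B := X * (2 * 2 ^ (rounds n).+1).
Let V := B * X.+1 * X.+1 * X.+1.

Let Z0 : 0 < Z. Proof. by rewrite /Z /base; lia. Qed.

Lemma base_le_bound i v : v <= Z ^ i -> i <= 2 * k + 4 -> 2 * v <= X.
Proof.
by move=> vi ik; rewrite leq_mul2l /= (leq_trans vi) // leq_pexp2l.
Qed.

Let nZ : n <= Z. Proof. by rewrite /Z /base; lia. Qed.
Let mZ : m <= Z. Proof. by rewrite /Z /base; lia. Qed.

Let dimZ (l : seq 'I_k) : size l <= k -> dim n l <= Z ^ k.
Proof.
move=> lk; rewrite /dim; apply: (@leq_trans (Z ^ (half l + half l))).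
  by case: (half l + half l) => // j; rewrite leq_exp2r.
rewrite leq_pexp2l // addnn (leq_trans _ lk) //.
by rewrite -[leqRHS]odd_double_half leq_addl.
Qed.

Lemma runs_tests ls s v : all (fun l => size l <= k) ls -> ready I X v s ->
  runs (foldr (fun l c => Seq (testP g l) c) Skip ls) s
    (budget V (foldr (fun l c => Seq (testP g l) c) Skip ls))
    (ready I X (v * all (fun l => passes g l I) ls)).
Proof.
have X1 : 1 < X by rewrite -[1.+1]muln1; apply: (base_le_bound (i := 0)).
have nX : n <= X by have := base_le_bound (i := 1) nZ; lia.
have mX : m * m <= X.
  by have := @base_le_bound 2 (m * m); rewrite -mulnn leq_mul //; lia.
elim: ls s v => [|l ls IH] s v /=.
  move=> _ rs; apply: (runs_skipU (b := B)); rewrite ?muln1 //.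
    by rewrite /B muln_gt0 (ltnW X1) muln_gt0 expn_gt0.
  by rewrite /V -!(mulnA B) leq_pmulr.
move=> /andP[lk lsk] rs; apply: runs_seqU.
have dX : 2 * dim n l * dim n l <= X.
  rewrite -mulnA; apply: (@base_le_bound (k + k)); last by lia.
  by rewrite expnD leq_mul ?dimZ.
have tX : 2 * scale n g l * (m * m) <= X.
  rewrite -mulnA; apply: (@base_le_bound (1 + (1 + k) + (1 + 1))); last by lia.
  rewrite !expnD expn1 /scale !leq_mul ?dimZ //.
    by rewrite /Z /base; lia.
  by case: odd; rewrite ?expn1.
apply: runs_weak (runs_test X1 nX dX mX tX rs) (leqnn _) _ => s1 rs1.
apply: runs_weak (IH _ _ lsk rs1) (leqnn _) _ => s2.
by rewrite -mulnA mulnb.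
Qed.

Lemma runs_certify ls : all (fun l => size l <= k) ls ->
  runs (certifyP ls) (load (encode I)) (budget (time_bound (n + m)) (certifyP ls))
    (fun s => s 1 0 = all (fun l => passes g l I) ls).
Proof.
move=> lsk.
have X1 : 1 < X by rewrite -[1.+1]muln1; apply: (base_le_bound (i := 0)).
have BT : B <= bit_bound (n + m).
  rewrite leq_mul2l expnS; apply/orP; right.
  by have := rounds_pow n; rewrite /base; lia.
have VT : V <= time_bound (n + m).
  by rewrite /V /time_bound !addn1 !leq_mul2r BT !orbT.
have B0 : 0 < B by rewrite /B muln_gt0 (ltnW X1) muln_gt0 expn_gt0.
have BV : B <= V by rewrite /V -!(mulnA B) leq_pmulr.
have XB v : v <= X -> v < 2 ^ B.
  move=> vX; apply: leq_ltn_trans (ltn_expl _ (isT : 1 < 2)).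
  by rewrite (leq_trans vX) // leq_pmulr // muln_gt0 expn_gt0.
have nX : n <= X by have := base_le_bound (i := 1) nZ; lia.
have mX : m <= X by have := base_le_bound (i := 1) mZ; lia.
have sb : small B (load (encode I)).
  move=> a i; rewrite /load; case: ifP => _; last by rewrite expn_gt0.
  apply: XB; case: i => [|[|i]] /=.
  - exact: nX.
  - exact: mX.
  have [ilt|ige] := ltnP i (size (flatten [seq encode_constraint C | C <- I])); last first.
    by rewrite nth_default.
  have /flattenP[_ /mapP[C _ ->]] := mem_nth 0 ilt.
  rewrite mem_cat => /orP[] /mapP[j _ ->].
    by case: (C.1 j) => //; exact: ltnW.
  exact: leq_trans (ltnW (ltn_ord _)) nX.
apply: (@runs_weak _ _ (budget V (certifyP ls)) _
  (ready I X (1 * all (fun l => passes g l I) ls))).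
- apply: runs_seqU; apply: (runs_writeU B0 BV sb); apply: runs_tests => //.
  split=> //.
    by apply: small_update => //; apply: XB; exact: ltnW.
- exact: budgetW.
- by move=> s [_ _]; rewrite mul1n.
Qed.

End Certify.

Lemma certify_poly_time k (P : predicate k) g ls :
  all (fun l : seq 'I_k => size l <= k)%N ls -> poly_time P (certifyP g ls).
Proof.
move=> lsk.
pose Zp : {poly nat} := 'X + (g * g + 2)%N%:P.
pose Xp : {poly nat} := 2%N%:P * Zp ^+ (2 * k + 4)%N.
exists ((40 * size_of (certifyP g ls))%N%:P *
  (Xp * (8%N%:P * Zp) * (Xp + 1) * (Xp + 1) * (Xp + 1))) => n I.
have [tm [s [E h _]]] := runs_certify g I lsk.
exists tm, s; split=> //; apply: leq_trans h _.
rewrite /Xp /Zp !(hornerM, hornerD, horner_exp, hornerX, hornerC) /budget.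
rewrite leq_mul2l; apply/orP; right.
by rewrite /time_bound /bit_bound /value_bound /base natrXE.
Qed.

Lemma certify_asserts k (P : predicate k) g ls n (I : instance P n) :
  all (fun l : seq 'I_k => size l <= k)%N ls ->
  asserts (certifyP g ls) I <-> all (fun l => passes g l I) ls.
Proof.
move=> lsk; have [tm [s [E _ h]]] := runs_certify g I lsk; split=> [[tm' [s' [E' h']]]|a].
  by move: h'; rewrite (exec_det E E') h; case: all.
by exists tm, s; split=> //; rewrite h a.
Qed.

(** * Quadratic forms at sign vectors and powers of symmetric matrices *)

Section Quadratic.
Variables (R : realType) (N : nat).
Implicit Types (A : 'M[R]_N) (x y : 'I_N -> R).

Definition form A x y := \sum_u \sum_v A u v * x u * y v.

(** By Lagrange's identity, twice the difference of the two sides is the sum of the squares of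
    [f i * h j - f j * h i]. *)
Lemma cauchy_schwarz (I : finType) (f h : I -> R) :
  (\sum_i f i * h i) ^+ 2 <= (\sum_i f i ^+ 2) * (\sum_i h i ^+ 2).
Proof.
have : 0 <= \sum_i \sum_j (f i * h j - f j * h i) ^+ 2.
  by do 2!(apply: sumr_ge0 => ? _); exact: sqr_ge0.
have -> : \sum_i \sum_j (f i * h j - f j * h i) ^+ 2 =
    2 * ((\sum_i f i ^+ 2) * (\sum_i h i ^+ 2) - (\sum_i f i * h i) ^+ 2).
  under eq_bigr do under eq_bigr do rewrite sqrrB !exprMn.
  under eq_bigr do rewrite big_split sumrB /=.
  rewrite big_split sumrB /= [\sum_i \sum_j f j ^+ 2 * _]exchange_big /=.
  have -> : \sum_i \sum_j f i ^+ 2 * h j ^+ 2 = (\sum_i f i ^+ 2) * (\sum_i h i ^+ 2).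
    by rewrite big_distrlr.
  have -> : \sum_i \sum_j f i * h j * (f j * h i) *+ 2 = (\sum_i f i * h i) ^+ 2 *+ 2.
    rewrite expr2 big_distrlr /= -sumrMnl; apply: eq_bigr => i _.
    by rewrite -sumrMnl; apply: eq_bigr => j _; congr (_ *+ 2); ring.
  by ring.
by rewrite pmulr_rge0 // subr_ge0.
Qed.

(** Cauchy-Schwarz for the scalar product of x and A x: the squared norm of x is [N], and that of A
    x is the form of A^2 by symmetry. *)
Lemma form_sqr_le A x : (forall u, x u ^+ 2 = 1) -> A^T = A ->
  (form A x x) ^+ 2 <= N%:R * form (A *m A) x x.
Proof.
move=> x1 sA; have sA' u v : A v u = A u v by rewrite -[in RHS]sA mxE.
have -> : form A x x = \sum_u x u * \sum_v A u v * x v.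
  by apply: eq_bigr => u _; rewrite big_distrr; apply: eq_bigr => v _ /=; ring.
apply: le_trans (cauchy_schwarz _ _) _.
under eq_bigr do rewrite x1.
rewrite sumr_const card_ord ler_wpM2l //.
have -> : form (A *m A) x x = \sum_u \sum_v \sum_w A u w * A w v * x u * x v.
  apply: eq_bigr => u _; apply: eq_bigr => v _; rewrite mxE !big_distrl.
  by apply: eq_bigr.
have -> : \sum_u (\sum_v A u v * x v) ^+ 2 =
    \sum_u \sum_v \sum_w A v u * A u w * x v * x w.
  apply: eq_bigr => u _; rewrite expr2 big_distrlr /=; apply: eq_bigr => v _.
  by apply: eq_bigr => w _ /=; rewrite [A v u]sA'; ring.
rewrite exchange_big /= le_eqVlt; apply/orP; left; apply/eqP.
by apply: eq_bigr => u _; rewrite exchange_big.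
Qed.

Lemma form_sqr_le_frobenius A x : (forall u, x u ^+ 2 = 1) ->
  (form A x x) ^+ 2 <= N%:R ^+ 2 * \sum_u \sum_v A u v ^+ 2.
Proof.
move=> x1; rewrite /form pair_big /= [X in _ * X]pair_big /=.
have := cauchy_schwarz (fun p : 'I_N * 'I_N => A p.1 p.2) (fun p => x p.1 * x p.2).
under [X in X ^+ 2]eq_bigr do rewrite mulrA.
move=> /le_trans; apply; rewrite mulrC ler_wpM2r ?sumr_ge0 // => [p _|].
  exact: sqr_ge0.
under eq_bigr do rewrite exprMn !x1 mulr1.
by rewrite sumr_const card_prod !card_ord natrM expr2.
Qed.

Lemma trmx_sqr A : A^T = A -> (A *m A)^T = A *m A.
Proof. by move=> sA; rewrite trmx_mul sA. Qed.

Lemma exp_square A r : iter r (fun B : 'M[R]_N => B *m B) A = A ^+ (2 ^ r).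
Proof. by elim: r => [|r IH]; rewrite ?expr1 // iterS IH expnSr exprM expr2. Qed.

(* Cauchy-Schwarz halves the exponent at the price of squaring the matrix. *)
Lemma form_le_exp A x r : (forall u, x u ^+ 2 = 1) -> A^T = A ->
  (form A x x) ^+ (2 ^ r.+1) <=
  N%:R ^+ (2 ^ r.+1) * \sum_u \sum_v (A ^+ (2 ^ r)) u v ^+ 2.
Proof.
move=> x1; elim: r A => [|r IH] A sA; first by rewrite expr1 form_sqr_le_frobenius.
have := IH _ (trmx_sqr sA); have := form_sqr_le x1 sA.
rewrite -[(A *m A) ^+ _](_ : A ^+ (2 ^ r.+1) = _); last by rewrite expnS exprM expr2.
set F2 := form (A *m A) x x => h1 h2.
have -> : (2 ^ r.+2 = 2 * 2 ^ r.+1)%N by rewrite expnS.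
rewrite exprM.
apply: (@le_trans _ _ ((N%:R * F2) ^+ (2 ^ r.+1))).
  by rewrite lerXn2r // ?nnegrE ?sqr_ge0 // (le_trans _ h1) ?sqr_ge0.
by rewrite exprMn mul2n -addnn exprD -mulrA ler_wpM2l // exprn_ge0.
Qed.

End Quadratic.

(** * Soundness of the tests *)

Section Signs.
Variables (R : realType) (k : nat) (P : predicate k) (n : nat).
Implicit Types (C : constraint P n) (I : instance P n) (l : seq 'I_k).

Definition chi l C : R := \prod_(i <- l) sgn R (C.1 i).

Lemma sgn_sqr b : sgn R b * sgn R b = 1.
Proof. by rewrite /sgn -expr2 sqrr_sign. Qed.

Lemma chi_bits l C : chi l C = (-1) ^+ sumn (bits l C).
Proof.
rewrite /chi; elim: l => [|i l IH]; first by rewrite big_nil.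
by rewrite big_cons IH -exprD.
Qed.

Lemma chi_negative l C C' : chi l C * chi l C' = (-1) ^+ negative l C C'.
Proof. by rewrite !chi_bits -exprD signr_odd sumn_cat. Qed.

Lemma sign_split l C C' :
  (negative l C C' == false)%:R - (negative l C C' == true)%:R = chi l C * chi l C' :> R.
Proof. by rewrite chi_negative; case: negative; rewrite ?expr0 ?expr1 ?sub0r ?subr0. Qed.

Definition signed_diagonal l I : R :=
  \sum_(C <- I) \sum_(C' <- I) (diagonal l C C')%:R * (chi l C * chi l C').

Definition link_matrix l I : 'M[R]_(dim n l) :=
  \matrix_(u, v) \sum_(C <- I) \sum_(C' <- I)
    (linked l C C')%:R * (chi l C * chi l C') * (hits l C C' u v)%:R.

Lemma diag0E l I :
  (diag0 l I false)%:R - (diag0 l I true)%:R = signed_diagonal l I.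
Proof.
rewrite /diag0 !natr_sum -sumrB; apply: eq_bigr => C _.
rewrite !natr_sum -sumrB; apply: eq_bigr => C' _.
by rewrite !natrM -mulrBr sign_split.
Qed.

Definition table_mx l (h : bool -> nat -> nat) : 'M[R]_(dim n l) :=
  \matrix_(u, v) ((h false (u * dim n l + v)%N)%:R - (h true (u * dim n l + v)%N)%:R).

Lemma row_index d (u v : 'I_d) : ((u * d + v) %/ d = u)%N.
Proof. by rewrite divnMDl ?divn_small ?addn0 //; apply: leq_ltn_trans (ltn_ord v). Qed.

Lemma col_index d (u v : 'I_d) : ((u * d + v) %% d = v)%N.
Proof. by rewrite modnMDl modn_small. Qed.

Lemma table0E g l I : table_mx l (table0 g l I) = (scale n g l)%:R *: link_matrix l I.
Proof.
apply/matrixP => u v; rewrite !mxE /table0 !natr_sum -sumrB big_distrr.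
apply: eq_bigr => C _; rewrite !natr_sum -sumrB /= big_distrr; apply: eq_bigr => C' _ /=.
rewrite row_index col_index !natrM -mulrBr -!mulrBl; congr (_ * (_ * _)).
by rewrite -mulrBr sign_split.
Qed.

Lemma square_mulmx l h : table_mx l (square n l h) = table_mx l h *m table_mx l h.
Proof.
apply/matrixP => u v; rewrite !mxE /square !natr_sum -sumrB; apply: eq_bigr => w _.
by rewrite !mxE row_index col_index !(natrD, natrM) /=; ring.
Qed.

Lemma iter_squareE l h j :
  table_mx l (iter j (square n l) h) = table_mx l h ^+ (2 ^ j).
Proof. by rewrite -exp_square; elim: j => //= j IH; rewrite square_mulmx IH. Qed.

Lemma frobenius_sum l h : (frobenius n l h false)%:R - (frobenius n l h true)%:R =
  \sum_u \sum_v table_mx l h u v ^+ 2.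
Proof.
rewrite /frobenius !natr_sum -sumrB.
transitivity (\sum_(i < dim n l * dim n l) ((h false i)%:R - (h true i)%:R) ^+ 2 : R).
  by apply: eq_bigr => i _; rewrite !(natrD, natrM) /=; ring.
rewrite -(big_mkord xpredT (fun i => ((h false i)%:R - (h true i)%:R) ^+ 2 : R)).
rewrite big_nat_mul big_mkord; apply: eq_bigr => u _.
rewrite -{1}[(u * dim n l)%N]add0n big_addn mulSn addnK big_mkord.
by apply: eq_bigr => v _; rewrite mxE addnC.
Qed.

Lemma link_matrix_sym l I : (link_matrix l I)^T = link_matrix l I.
Proof.
apply/matrixP => u v; rewrite !mxE; do 2!(apply: eq_bigr => ? _).
by congr (_ * _%:R); rewrite /hits addnC; congr (_ + _)%N; rewrite mulnC.
Qed.

Lemma passesE g l I : passes g l I =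
  (2 * (g%:R ^+ 2 * n%:R ^+ odd (size l)) * signed_diagonal l I <=
     (size I)%:R ^+ 2) &&
  (\sum_u \sum_v (((scale n g l)%:R *: link_matrix l I) ^+ (2 ^ rounds n)) u v ^+ 2 <=
     ((size I)%:R ^+ 2) ^+ (2 * 2 ^ rounds n)).
Proof.
rewrite /passes -diag0E -table0E -iter_squareE -frobenius_sum; congr (_ && _).
  rewrite mulrBr lerBlDr -(ler_nat R) !(natrD, natrM, natrX).
  by rewrite !expr2.
rewrite lerBlDr -(ler_nat R) natrD !natrX natrM -expr2 -exprM.
by rewrite [(2 ^ _ * 2)%N]mulnC.
Qed.

End Signs.

Section Soundness.
Variables (R : realType) (k : nat) (P : predicate k) (n : nat) (x : cube n).
Implicit Types (C : constraint P n) (I : instance P n) (l r : seq 'I_k).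

Definition monom r C : R := \prod_(i <- r) sgn R (x (C.2 i)).

(** The default 1 lets [sign_vector] have entries of square 1 at every index, valid or not. *)
Definition sign_at (d : nat) : R := if insub d is Some i then sgn R (x i) else 1.

Definition sign_vector a w : R := \prod_(d <- decode n a w) sign_at d.

Lemma sign_vector_sqr a w : sign_vector a w ^+ 2 = 1.
Proof.
rewrite /sign_vector -prodrXl big1 // => d _; rewrite /sign_at.
by case: insub => [i|]; rewrite ?expr1n // expr2 sgn_sqr.
Qed.

Lemma digits_lt r C : all (ltn^~ n) (digits r C).
Proof. by apply/allP => _ /mapP[i _ ->] /=; exact: ltn_ord. Qed.

Lemma size_digits r C : size (digits r C) = size r.
Proof. exact: size_map. Qed.

Lemma prod_digits r C : \prod_(d <- digits r C) sign_at d = monom r C.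
Proof.
rewrite big_map; apply: eq_bigr => i _; rewrite /sign_at.
case: insubP => [j _ ej|]; last by rewrite ltn_ord.
by congr sgn; congr (x _); apply: val_inj.
Qed.

Lemma sign_vector_code r C :
  sign_vector (size r) (code n (digits r C)) = monom r C.
Proof. by rewrite /sign_vector -(size_digits r C) decode_code ?digits_lt ?prod_digits. Qed.

Lemma sign_vector_code2 r r' C C' :
  sign_vector (size r + size r') (code n (digits r C ++ digits r' C')) =
  monom r C * monom r' C'.
Proof.
rewrite /sign_vector -(size_digits r C) -(size_digits r' C') -size_cat decode_code.
  by rewrite big_cat !prod_digits.
by rewrite all_cat !digits_lt.
Qed.

Lemma monom_sqr r C : monom r C * monom r C = 1.
Proof. by rewrite -sign_vector_code -expr2 sign_vector_sqr. Qed.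

Lemma half_le l : (half l + half l <= size l)%N.
Proof. by rewrite addnn -[leqRHS]odd_double_half leq_addl. Qed.

Lemma size_side l o : size (side l o) = half l.
Proof.
have := half_le l; case: o => h; rewrite /side size_take_min ?size_drop.
  by apply/minn_idPl; lia.
by apply/minn_idPl; lia.
Qed.

Lemma size_odd_part l : size (odd_part l) = odd (size l).
Proof.
rewrite /odd_part !size_drop /half -{1}[size l]odd_double_half.
by case: odd; lia.
Qed.

Lemma side_cat l : (side l true ++ side l false) ++ odd_part l = l.
Proof. by rewrite -catA /side /odd_part !cat_take_drop. Qed.

Lemma vertex_lt l o C C' : (vertex l o C C' < dim n l)%N.
Proof.
have := @code_lt n (digits (side l o) C ++ digits (side l o) C').
by rewrite all_cat !digits_lt size_cat !size_digits !size_side; apply.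
Qed.

Lemma code_odd_lt l C : (code n (digits (odd_part l) C) < n ^ odd (size l))%N.
Proof.
have := @code_lt n (digits (odd_part l) C).
by rewrite digits_lt size_digits size_odd_part; apply.
Qed.

Lemma sign_vector_vertex l o C C' :
  sign_vector (half l + half l) (vertex l o C C') = monom (side l o) C * monom (side l o) C'.
Proof. by rewrite /vertex -[in LHS](size_side l o) sign_vector_code2. Qed.

Lemma sum_delta d (w : nat) (F : nat -> R) : (w < d)%N ->
  \sum_(u < d) ((w == u)%:R * F u) = F w.
Proof.
move=> wd; rewrite (bigD1 (Ordinal wd)) //= eqxx mul1r big1 ?addr0 // => u uw.
by rewrite (_ : w == u = false) ?mul0r //; apply: contraNF uw => /eqP wu; apply/eqP/val_inj.
Qed.

Definition off_diagonal l I : R := \sum_(C <- I) \sum_(C' <- I)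
  (linked l C C')%:R * (chi R l C * chi R l C') *
  (sign_vector (half l + half l) (vertex l true C C') *
   sign_vector (half l + half l) (vertex l false C C')).

Lemma form_link_matrix l I (s := fun u : 'I_(dim n l) => sign_vector (half l + half l) u) :
  form (link_matrix R l I) s s = 2 * off_diagonal l I.
Proof.
rewrite /form /off_diagonal.
under eq_bigr => u _.
  under eq_bigr => v _.
    rewrite mxE 2!big_distrl /=.
    under eq_bigr => C _ do rewrite 2!big_distrl /=.
    over.
  rewrite exchange_big /=.
  under eq_bigr => C _ do rewrite exchange_big /=.
  over.
rewrite exchange_big big_distrr /=; apply: eq_bigr => C _.
rewrite exchange_big big_distrr /=; apply: eq_bigr => C' _.
set c := _%:R * _; pose sv := sign_vector (half l + half l).
set v1 := vertex l true C C'; set v2 := vertex l false C C'.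
transitivity (c * \sum_(u < dim n l) \sum_(v < dim n l)
   (((v1 == u)%:R * sv u) * ((v2 == v)%:R * sv v) +
    ((v2 == u)%:R * sv u) * ((v1 == v)%:R * sv v))).
  rewrite big_distrr; apply: eq_bigr => u _ /=.
  rewrite big_distrr; apply: eq_bigr => v _ /=.
  by rewrite /hits natrD !natrM /s /sv; ring.
under eq_bigr do rewrite big_split /= -!big_distrr /=.
rewrite big_split /= -!big_distrl /= !(sum_delta sv) ?vertex_lt //.
by rewrite -/sv; ring.
Qed.

Definition character_sum l I : R := \sum_(C <- I) chi R l C * monom l C.

(** The unknown signs of the odd coordinate are the weights removed by Cauchy-Schwarz; they take
    [n ^ odd (size l)] values, the factor lost. *)
Lemma character_sum_sqr l I :
  character_sum l I ^+ 2 <=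
  (n ^ odd (size l))%:R * (signed_diagonal R l I + off_diagonal l I).
Proof.
set e := (n ^ _)%N; pose uv := side l true ++ side l false.
pose f C : R := chi R l C * monom uv C.
pose q (y : nat) : R := \sum_(C <- I) (code n (digits (odd_part l) C) == y)%:R * f C.
have -> : character_sum l I = \sum_(y < e) sign_vector (odd (size l)) y * q y.
  under [RHS]eq_bigr do rewrite big_distrr /=.
  rewrite exchange_big; apply: eq_bigr => C _ /=.
  under eq_bigr do rewrite mulrCA.
  rewrite (sum_delta (fun y => _ y * _)) ?code_odd_lt //.
  rewrite -size_odd_part sign_vector_code /f mulrCA; congr (_ * _).
  by rewrite -[in LHS](side_cat l) /monom big_cat mulrC.
apply: le_trans (cauchy_schwarz _ _) _.
under eq_bigr do rewrite sign_vector_sqr.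
rewrite sumr_const card_ord ler_wpM2l // le_eqVlt; apply/orP; left; apply/eqP.
transitivity (\sum_(C <- I) \sum_(C' <- I) (same (odd_part l) C C')%:R * (f C * f C')).
  under eq_bigr do rewrite expr2 big_distrlr /=.
  rewrite exchange_big; apply: eq_bigr => C _.
  rewrite exchange_big; apply: eq_bigr => C' _ /=.
  under eq_bigr do rewrite mulrACA -mulrA.
  rewrite (sum_delta (fun y => (_ == y)%:R * _)) ?code_odd_lt //.
  by rewrite /same [_ == code _ _]eq_sym.
rewrite /signed_diagonal /off_diagonal -big_split; apply: eq_bigr => C _.
rewrite -big_split; apply: eq_bigr => C' _ /=.
rewrite /diagonal /linked; case: (same (odd_part l) C C'); last by rewrite !mul0r addr0.
case s: (same _ C C') => /=; rewrite ?mul0r ?addr0 ?add0r ?mul1r.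
  (* Both constraints have the same variables on the two blocks, so the signs of [x] cancel. *)
  suff -> : f C * f C' = chi R l C * chi R l C' * (monom uv C * monom uv C).
    by rewrite monom_sqr mulr1.
  rewrite /f -(sign_vector_code uv C') -(eqP s) sign_vector_code; ring.
(* The four half monomials are regrouped by block instead of by constraint. *)
rewrite !sign_vector_vertex /f /monom !big_cat /=; ring.
Qed.

Lemma passes_character_sum g l I : (0 < g)%N -> passes g l I ->
  g%:R * `|character_sum l I| <= (size I)%:R.
Proof.
move=> g0; rewrite (passesE R) => /andP[hD hF].
set m : R := (size I)%:R in hD hF *.
set z := character_sum l I; set e : R := n%:R ^+ odd (size l) in hD.
have zle : z ^+ 2 <= e * (signed_diagonal R l I + off_diagonal l I).
  by rewrite /e -natrX; exact: character_sum_sqr.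
have hO : g%:R ^+ 2 * e * (2 * off_diagonal l I) <= m ^+ 2.
  (* A zero dimension cannot be cancelled below, but then the form is an empty sum. *)
  have [d0|d0] := posnP (dim n l).
    rewrite -form_link_matrix /form big1 ?mulr0 ?sqr_ge0 // => u.
    by have := ltn_ord u; rewrite {2}d0.
  pose s := fun u : 'I_(dim n l) => sign_vector (half l + half l) u.
  have s1 u : s u ^+ 2 = 1 by exact: sign_vector_sqr.
  pose A := (scale n g l)%:R *: link_matrix R l I.
  have sA : A^T = A by rewrite linearZ /= link_matrix_sym.
  have := form_le_exp (rounds n) s1 sA.
  move=> /le_trans /(_ (ler_wpM2l _ hF)); rewrite exprn_ge0 // => /(_ isT).
  rewrite -expnS -exprMn => h.
  (* The exponent [2 ^ (rounds n).+1] is even, so taking roots bounds the absolute value of the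
     form. The factor [dim n l] cancels against the one in [scale]. *)
  have : form A s s <= (dim n l)%:R * m ^+ 2.
    apply: le_trans (ler_norm _) _.
    rewrite -(@ler_pXn2r _ (2 ^ (rounds n).+1)) ?expn_gt0 //.
    + by rewrite -normrX ger0_norm // expnS exprM exprn_ge0 ?sqr_ge0.
    + by rewrite nnegrE mulr_ge0 ?sqr_ge0.
  have -> : form A s s = (scale n g l)%:R * (2 * off_diagonal l I).
    rewrite -form_link_matrix /form big_distrr; apply: eq_bigr => u _ /=.
    by rewrite big_distrr; apply: eq_bigr => v _ /=; rewrite mxE -!mulrA.
  rewrite /scale !natrM natrX -expr2 -/e => h'.
  have d0' : 0 < (dim n l)%:R :> R by rewrite ltr0n.
  rewrite -(ler_pM2l d0'); apply: le_trans h'.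
  by rewrite le_eqVlt; apply/orP; left; apply/eqP; ring.
have gz : (g%:R * `|z|) ^+ 2 <= m ^+ 2.
  rewrite exprMn real_normK ?num_real //.
  have : g%:R ^+ 2 * z ^+ 2 <= g%:R ^+ 2 * (e * (signed_diagonal R l I + off_diagonal l I)).
    by rewrite ler_wpM2l ?sqr_ge0.
  lra.
by move: gz; rewrite ler_pXn2r ?nnegrE ?mulr_ge0 ?ler0n.
Qed.

End Soundness.

(** * From character sums to quasirandomness *)

Section Quasirandom.
Variables (R : realType) (k : nat) (P : predicate k) (n : nat).
Implicit Types (I : instance P n) (x : cube n).

Definition low_degree (t : nat) : seq (seq 'I_k) :=
  map (fun A : {set 'I_k} => enum A) (enum [set A : {set 'I_k} | 0 < #|A| <= t]%N).

Lemma low_degree_size t : all (fun l : seq 'I_k => size l <= k)%N (low_degree t).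
Proof.
by apply/allP => _ /mapP[A _ ->]; rewrite -cardE -[leqRHS]card_ord max_card.
Qed.

Lemma expectation_induced I x (f : cube k -> R) :
  Defs.expectation (induced R I x) f =
  (size I)%:R^-1 * \sum_(C <- I) f (hadamard C.1 (Defs.restrict x C.2)).
Proof.
rewrite /Defs.expectation /induced.
transitivity ((size I)%:R^-1 * \sum_z \sum_(C <- I)
    (hadamard C.1 (Defs.restrict x C.2) == z)%:R * f z).
  rewrite big_distrr; apply: eq_bigr => z _ /=; rewrite mulrAC mulrC; congr (_ * _).
  rewrite -big_distrl /=; congr (_ * _); rewrite -natr_sum -sum1_count.
  by rewrite big_mkcond; congr _%:R; apply: eq_bigr => C _; case: (_ == _).
rewrite exchange_big; congr (_ * _); apply: eq_bigr => C _ /=.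
rewrite (bigD1 (hadamard C.1 (Defs.restrict x C.2))) //= eqxx mul1r big1 ?addr0 // => z.
by rewrite eq_sym => /negbTE ->; rewrite mul0r.
Qed.

Lemma passes_quasirandom (gamma : R) (g t : nat) I : (0 < g)%N -> 1 <= g%:R * gamma ->
  all (fun l => passes g l I) (low_degree t) -> quasirandom gamma t I.
Proof.
move=> g0 gg /allP ap x S St.
have /ap /(passes_character_sum R x g0) h : enum S \in low_degree t.
  by apply/mapP; exists S => //; rewrite mem_enum inE.
rewrite expectation_induced.
have -> : \sum_(C <- I) \prod_(i in S) sgn R (hadamard C.1 (Defs.restrict x C.2) i)
   = character_sum R x (enum S) I.
  apply: eq_bigr => C _; rewrite /chi /monom -big_split big_enum /=.
  apply: eq_bigr => i _; rewrite !ffunE /sgn.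
  by case: (C.1 i); case: (x _); rewrite ?expr0 ?expr1 ?mulr1 ?mul1r ?mulrN1 ?opprK.
rewrite normrM normfV normr_nat.
(* For the empty instance the expectation is 0, as the inverse of 0 is 0, and [gamma >= 0] follows
   from [1 <= g%:R * gamma]. *)
have [m0|m0] := posnP (size I).
  rewrite m0 invr0 mul0r; rewrite -(pmulr_rge0 gamma (x := g%:R)) ?ltr0n //.
  exact: le_trans gg.
have m0' : 0 < (size I)%:R :> R by rewrite ltr0n.
rewrite mulrC ler_pdivrMr // -(ler_pM2l (_ : 0 < g%:R)) ?ltr0n //.
rewrite (le_trans h) // mulrA ler_peMl // ltW //.
Qed.

End Quasirandom.

(** * Means, Markov's inequality and moments of centered indicators *)

Section Moments.
Variables (R : realType) (k : nat) (P : predicate k) (n : nat) (p : R).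
Hypothesis (p01 : 0 <= p <= 1).
Local Notation K := (constraint P n).
Implicit Types (C : K) (J : {set K}) (L : seq K) (f h : {set K} -> R)
  (E : pred {set K}).

Definition mean f : R := \sum_J random_csp p J * f J.

Let p0 : 0 <= p. Proof. by case/andP: p01. Qed.
Let p1 : p <= 1. Proof. by case/andP: p01. Qed.

Lemma random_csp_ge0 J : 0 <= random_csp p J.
Proof. by apply: prodr_ge0 => C _; case: ifP => _ //; rewrite subr_ge0. Qed.

Lemma mean_prod (w : K -> bool -> R) :
  mean (fun J => \prod_C w C (C \in J)) = \prod_C (p * w C true + (1 - p) * w C false).
Proof.
rewrite /mean bigA_distr; apply: eq_bigr => J _.
by rewrite /random_csp -big_split; apply: eq_bigr => C _; case: (C \in J).
Qed.

Lemma eq_mean f h : f =1 h -> mean f = mean h.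
Proof. by move=> e; apply: eq_bigr => J _; rewrite e. Qed.

Lemma meanZ a f : mean (fun J => a * f J) = a * mean f.
Proof. by rewrite /mean big_distrr; apply: eq_bigr => J _ /=; rewrite mulrCA. Qed.

Lemma mean_sum (T : Type) (r : seq T) (Q : pred T) (F : T -> {set K} -> R) :
  mean (fun J => \sum_(i <- r | Q i) F i J) = \sum_(i <- r | Q i) mean (F i).
Proof.
rewrite /mean exchange_big /=; apply: eq_bigr => J _; by rewrite big_distrr.
Qed.

Definition prob (E : pred {set K}) : R := \sum_(J | E J) random_csp p J.

Lemma prob_ge0 E : 0 <= prob E.
Proof. by apply: sumr_ge0 => J _; exact: random_csp_ge0. Qed.

Lemma prob_le E (E' : pred {set K}) : (forall J, E J -> E' J) -> prob E <= prob E'.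
Proof.
move=> EE; rewrite /prob [leLHS]big_mkcond [leRHS]big_mkcond; apply: ler_sum => J _.
by case: ifP => [/EE -> //|_]; case: ifP => // _; exact: random_csp_ge0.
Qed.

Lemma prob_union E (E' : pred {set K}) : prob (fun J => E J || E' J) <= prob E + prob E'.
Proof.
rewrite /prob [leLHS]big_mkcond [X in _ <= X + _]big_mkcond [X in _ <= _ + X]big_mkcond.
rewrite -big_split; apply: ler_sum => J _ /=.
by have := random_csp_ge0 J; case: (E J); case: (E' J) => /=; lra.
Qed.

Lemma prob_has (T : eqType) (r : seq T) (E : T -> pred {set K}) :
  prob (fun J => has (E^~ J) r) <= \sum_(i <- r) prob (E i).
Proof.
elim: r => [|i r IH]; first by rewrite big_nil /prob big_pred0.
by rewrite big_cons /=; apply: le_trans (prob_union _ _) _; rewrite lerD2l.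
Qed.

Lemma markov_mean f E a b : 0 < a -> (forall J, 0 <= f J) ->
  (forall J, E J -> a <= f J) -> mean f <= b -> prob E <= b / a.
Proof.
move=> a0 f0 fa fb; rewrite ler_pdivlMr // (le_trans _ fb) // /prob big_distrl /=.
rewrite /mean [leLHS]big_mkcond; apply: ler_sum => J _; case: ifP => [/fa h|_].
  by rewrite ler_wpM2l ?random_csp_ge0.
by rewrite mulr_ge0 ?random_csp_ge0.
Qed.

Definition eta C J : R := (C \in J)%:R - p.

Definition repeated L := all (fun C => count_mem C L != 1%N) L.

Definition weight_of L : R := if repeated L then p ^+ size (undup L) else 0.

Lemma prod_count (F : K -> R) L : \prod_(C <- L) F C = \prod_C F C ^+ count_mem C L.
Proof.
elim: L => [|C L IH]; first by rewrite big_nil big1.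
rewrite big_cons IH /=; under [RHS]eq_bigr do rewrite exprD.
rewrite big_split /=; congr (_ * _); rewrite (bigD1 C) //= eqxx expr1 big1 ?mulr1 //.
by move=> C' CC'; rewrite eq_sym (negbTE CC').
Qed.

(** For j >= 2 the two terms are at most p (1 - p) and (1 - p) p^2 in absolute value, and these add
    up to p - p^3. *)
Lemma central_moment j : (1 < j)%N -> `|p * (1 - p) ^+ j + (1 - p) * (- p) ^+ j| <= p.
Proof.
case: j => [|[|j]] // _.
have q0 : 0 <= 1 - p by rewrite subr_ge0.
have h1 : (1 - p) ^+ j.+2 <= 1 - p.
  by rewrite exprS ler_piMr // exprn_ile1 // lerBlDr lerDl.
have h2 : p ^+ j.+2 <= p * p by rewrite 2!exprS ler_wpM2l // ler_piMr // exprn_ile1.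
apply: le_trans (ler_normD _ _) _; 
rewrite (normrM p) (normrM (1 - p) (_ ^+ _)) !normrX normrN !ger0_norm //.
apply: (@le_trans _ _ (p * (1 - p) + (1 - p) * (p * p))).
  by rewrite lerD // ler_wpM2l.
have : 0 <= p * (p * p) by rewrite !mulr_ge0.
by lra.
Qed.

(** By independence the mean factors over the constraints: a constraint listed once contributes a
    centered mean, which is 0, and one listed more often at most [p]. *)
Lemma mean_eta L : `|mean (fun J => \prod_(C <- L) eta C J)| <= weight_of L.
Proof.
rewrite (eq_mean (fun J => prod_count (eta^~ J) L)).
rewrite (mean_prod (fun C b => (b%:R - p) ^+ count_mem C L)) /weight_of.
case: ifP => [/allP rL|].
  rewrite normr_prod -(card_uniqP (undup_uniq L)) -prodr_const [leRHS]big_mkcond /=.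
  apply: ler_prod => C _; rewrite normr_ge0 sub0r mem_undup.
  case: ifPn => [CL|]; last first.
    by move=> /count_memPn ->; rewrite !expr0 !mulr1 addrC subrK normr1 lexx.
  apply: central_moment; have := rL _ CL.
  by rewrite -has_pred1 has_count in CL; case: (count_mem C L) CL => [|[|]].
move=> /negbT /allPn[C CL]; rewrite negbK => /eqP c1.
rewrite (bigD1 C) //= c1 !expr1.
have -> : p * (true%:R - p) + (1 - p) * (false%:R - p) = 0 by rewrite /=; ring.
by rewrite mul0r normr0.
Qed.

Lemma sum_count L : (\sum_C count_mem C L = size L)%N.
Proof.
elim: L => [|C L IH]; first by rewrite big1.
rewrite big_split /= IH -add1n; congr addn.
by rewrite (bigD1 C) //= eqxx big1 // => C' CC'; rewrite eq_sym (negbTE CC').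
Qed.

Lemma repeated_size L : repeated L -> (2 * size (undup L) <= size L)%N.
Proof.
move=> /allP rL; rewrite -[leqRHS]sum_count -(card_uniqP (undup_uniq L)) mulnC.
rewrite -sum_nat_const [leqLHS]big_mkcond /=; apply: leq_sum => C _.
rewrite mem_undup; case: ifP => // CL; have := rL _ CL.
by rewrite -has_pred1 has_count in CL; case: (count_mem C L) CL => [|[|]].
Qed.

(* Sums of signs over negations vanish, so the indicators may be centered. *)
Lemma center_sum (l : seq 'I_k) J (F : K -> R) : uniq l -> (0 < size l)%N ->
  (forall C C', C.2 = C'.2 -> F C = F C') ->
  \sum_(C in J) chi R l C * F C = \sum_C eta C J * (chi R l C * F C).
Proof.
move=> ul l0 F2; rewrite /eta; under [RHS]eq_bigr do rewrite mulrBl.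
rewrite sumrB -big_distrr /= [X in _ - p * X](_ : _ = 0); last first.
  pose c0 : cube k := [ffun=> false].
  pose h (i : 'I_k) b : R := if i \in l then sgn R b else 1.
  transitivity (\sum_(c : cube k) \sum_(T : scope k n)
      (\prod_i h i (c i)) * F (c0, T)).
    rewrite pair_big; apply: eq_bigr => C _ /=; congr (_ * _); last exact: F2.
    by rewrite /chi big_uniq //= big_mkcond.
  rewrite exchange_big big1 //= => T _; rewrite -big_distrl /=.
  rewrite -(bigA_distr_bigA h) /=.
  have [i il] : exists i, i \in l by case: (l) l0 => // i ? _; exists i; rewrite mem_head.
  by rewrite (bigD1 i) //= big_bool /h il /sgn /= expr1 expr0 addNr !mul0r.
rewrite mulr0 subr0 big_mkcond; apply: eq_bigr => C _.
by case: (C \in J); rewrite ?mul1r ?mul0r.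
Qed.

End Moments.

(** * Moments of a random instance *)

Section Walks.
Variables (R : realType) (k : nat) (P : predicate k) (n : nat) (p : R) (l : seq 'I_k).
Hypotheses (p01 : 0 <= p <= 1) (n0 : (0 < n)%N) (ul : uniq l) (l0 : (0 < size l)%N).
Local Notation K := (constraint P n).
Implicit Types (C D : K) (J : {set K}) (L : seq K).

Let p0 : 0 <= p. Proof. by case/andP: p01. Qed.

Lemma card_digits (r : seq 'I_k) (ds : seq nat) : uniq r ->
  (#|[set C : K | digits r C == ds]| <= 2 ^ k * n ^ (k - size r))%N.
Proof.
move=> ur.
pose F (i : 'I_k) : pred 'I_n := [pred j | (i \in r) ==> (nat_of_ord j == nth 0 ds (index i r))%N].
apply: (@leq_trans #|finset.setX [set: cube k] [set T : scope k n | T \in family F]|).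
  apply: subset_leq_card; apply/fintype.subsetP => -[c T].
  rewrite finset.in_set finset.in_setX !finset.in_set /= => /eqP eds.
  apply/familyP => i; rewrite inE /=; apply/implyP => ir.
  by rewrite -eds (nth_map i) ?index_mem // nth_index.
rewrite cardsX cardsT card_ffun card_bool card_ord leq_mul2l; apply/orP; right.
rewrite cardsE card_family.
have -> : (foldr muln 1 [seq #|F x| | x : 'I_k] = \prod_(i : 'I_k) #|F i|)%N.
  by rewrite foldrE big_map big_enum.
apply: (@leq_trans (\prod_(i : 'I_k) if i \in r then 1 else n)%N).
  apply: leq_prod => i _; case: ifPn => ir.
    apply/card_le1_eqP => x y; rewrite !inE ir /= => /eqP hx /eqP hy.
    by apply: val_inj; rewrite /= hx hy.
  rewrite -[leqRHS]card_ord; exact: max_card.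
rewrite big_if /= prod_nat_const exp1n mul1n prod_nat_const.
have := cardC (mem r); rewrite card_ord (card_uniqP ur) => kr.
rewrite leq_pexp2l // (_ : #|_| = #|[predC mem r]|).
  by rewrite -[leqLHS](addKn (size r)) kr.
by apply: eq_card => i; rewrite !inE.
Qed.

Lemma eq_digits (r : seq 'I_k) C C' : C.2 = C'.2 -> digits r C = digits r C'.
Proof. by move=> e; rewrite /digits e. Qed.

Lemma linked_eq C C' D D' : C.2 = D.2 -> C'.2 = D'.2 -> linked l C C' = linked l D D'.
Proof.
by move=> e e'; rewrite /linked /same !(eq_digits _ e) !(eq_digits _ e').
Qed.

Lemma diagonal_eq C C' D D' : C.2 = D.2 -> C'.2 = D'.2 -> diagonal l C C' = diagonal l D D'.
Proof.
by move=> e e'; rewrite /diagonal /same !(eq_digits _ e) !(eq_digits _ e').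
Qed.

Lemma hits_eq C C' D D' u v : C.2 = D.2 -> C'.2 = D'.2 -> hits l C C' u v = hits l D D' u v.
Proof.
by move=> e e'; rewrite /hits /vertex !(eq_digits _ e) !(eq_digits _ e').
Qed.

Lemma center_sum2 J (F : K -> K -> R) :
  (forall C C' D D', C.2 = D.2 -> C'.2 = D'.2 -> F C C' = F D D') ->
  \sum_(C <- enum J) \sum_(C' <- enum J) F C C' * (chi R l C * chi R l C') =
  \sum_C \sum_C' (eta p C J * eta p C' J) * (F C C' * (chi R l C * chi R l C')).
Proof.
move=> FE.
transitivity (\sum_(C in J) chi R l C * \sum_C' eta p C' J * (chi R l C' * F C C')).
  rewrite big_enum /=; apply: eq_bigr => C _.
  rewrite -(center_sum p J ul l0) => [|C' D' e]; last exact: FE.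
  rewrite big_enum big_distrr /=; apply: eq_bigr => C' _; ring.
rewrite (center_sum p J ul l0) => [|C D e].
  apply: eq_bigr => C _; rewrite 2!big_distrr /=; apply: eq_bigr => C' _; ring.
by apply: eq_bigr => C' _; congr (_ * (_ * _)); exact: FE.
Qed.

Lemma link_matrix_eta J u v : link_matrix R l (enum J) u v =
  \sum_C \sum_C' (eta p C J * eta p C' J) *
    ((linked l C C')%:R * (hits l C C' u v)%:R * (chi R l C * chi R l C')).
Proof.
rewrite mxE -center_sum2 => [|C C' D D' e e'].
  by do 2!(apply: eq_bigr => ? _); rewrite mulrAC.
by rewrite (linked_eq e e') (hits_eq u v e e').
Qed.

Lemma signed_diagonal_eta J : signed_diagonal R l (enum J) =
  \sum_C \sum_C' (eta p C J * eta p C' J) *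
    ((diagonal l C C')%:R * (chi R l C * chi R l C')).
Proof.
by rewrite -center_sum2 // => C C' D D' e e'; rewrite (diagonal_eq e e').
Qed.

(** [u] is the current vertex and [L] lists the constraints met so far. The weight is charged at the
    end, because being repeated is a property of the whole list. *)
Fixpoint walks (j u : nat) L : R :=
  if j is j'.+1 then
    \sum_C \sum_C' \sum_(o : bool)
      (linked l C C' && (vertex l o C C' == u))%:R *
      walks j' (vertex l (~~ o) C C') [:: C, C' & L]
  else weight_of p L.

Lemma norm_chi C : `|chi R l C| = 1.
Proof. by rewrite chi_bits normrX normrN1 expr1n. Qed.

(** Expanding the first factor of the power gives one step, whose two constraints join [L]. The
    signs [chi] have absolute value 1 and disappear, so that only counting remains. *)
Lemma mean_walks j (u v : 'I_(dim n l)) L :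
  `|mean p (fun J => \prod_(C <- L) eta p C J * (link_matrix R l (enum J) ^+ j) u v)|
    <= walks j u L.
Proof.
elim: j u L => [|j IH] u L.
  (* The closing condition [u == v] is bounded by 1: the end of the walk is left free. *)
  rewrite (@eq_mean _ _ _ _ _ _ (fun J => (u == v)%:R * \prod_(C <- L) eta p C J)).
    rewrite meanZ normrM normr_nat; case: (u == v); rewrite ?mul1r ?mul0r ?mean_eta //.
    by rewrite /= /weight_of; case: ifP => // _; rewrite exprn_ge0.
  by move=> J; rewrite expr0 mulrC mxE.
have hE C C' (w : 'I_(dim n l)) : (hits l C C' u w)%:R =
   \sum_(o : bool) (vertex l o C C' == u)%:R * (vertex l (~~ o) C C' == w)%:R :> R.
  by rewrite big_bool /hits natrD !natrM.
rewrite (@eq_mean _ _ _ _ _ _ (fun J => \sum_C \sum_C' \sum_(o : bool) \sum_(w < dim n l)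
  ((linked l C C' && (vertex l o C C' == u))%:R * (vertex l (~~ o) C C' == w)%:R
    * (chi R l C * chi R l C')) *
  (\prod_(D <- [:: C, C' & L]) eta p D J * (link_matrix R l (enum J) ^+ j) w v))).
  rewrite [leRHS]/= mean_sum; apply: le_trans (ler_norm_sum _ _ _) _; apply: ler_sum => C _.
  rewrite mean_sum; apply: le_trans (ler_norm_sum _ _ _) _; apply: ler_sum => C' _.
  rewrite mean_sum; apply: le_trans (ler_norm_sum _ _ _) _; apply: ler_sum => o _.
  rewrite mean_sum; apply: le_trans (ler_norm_sum _ _ _) _.
  rewrite -(sum_delta (fun w => walks j w [:: C, C' & L]) (vertex_lt l (~~ o) C C')).
  rewrite big_distrr /=; apply: ler_sum => w _.
  rewrite meanZ !normrM !normr_nat !norm_chi !mulr1 -mulrA.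
  by rewrite !ler_wpM2l ?ler0n.
move=> J; rewrite exprS mxE big_distrr /=.
transitivity (\sum_(w < dim n l) \sum_C \sum_C' \sum_(o : bool)
  ((linked l C C' && (vertex l o C C' == u))%:R * (vertex l (~~ o) C C' == w)%:R
    * (chi R l C * chi R l C')) *
  (\prod_(D <- [:: C, C' & L]) eta p D J * (link_matrix R l (enum J) ^+ j) w v)).
  apply: eq_bigr => w _; rewrite link_matrix_eta big_distrl big_distrr /=.
  apply: eq_bigr => C _; rewrite big_distrl big_distrr /=; apply: eq_bigr => C' _.
  transitivity ((\prod_(D <- L) eta p D J * (eta (P := P) p C J * eta (P := P) p C' J) *
    (linked (P := P) l C C')%:R * (chi R (P := P) l C * chi R (P := P) l C') *
    (link_matrix R l (enum J) ^+ j) w v) * (hits (P := P) l C C' u w)%:R); first by ring.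
  rewrite hE big_distrr /=.
  apply: eq_bigr => o _; rewrite !big_cons -mulnb natrM; ring.
rewrite exchange_big; apply: eq_bigr => C _.
rewrite exchange_big; apply: eq_bigr => C' _.
by rewrite exchange_big.
Qed.

End Walks.

(** * Counting walks, and the resulting means *)

Section Count.
Variables (R : realType) (k : nat) (P : predicate k) (n : nat) (p : R) (l : seq 'I_k).
Hypotheses (p01 : 0 <= p <= 1) (n0 : (0 < n)%N) (ul : uniq l) (l0 : (0 < size l)%N).
Local Notation K := (constraint P n).
Implicit Types (C D : K) (J : {set K}) (L : seq K).

Definition fiber : R := (2 ^ k * n ^ (k - (half l + odd (size l))))%:R.
Definition root : R := Num.sqrt n%:R.
(** Two new constraints in a step have at most n^e [fiber]^2 choices. The inverse is shared equally
    between them, and [root] splits the odd coordinate that they have in common. *)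
Definition rate : R := (root ^+ odd (size l) * fiber)^-1.

Lemma sum_pred (Q : pred K) : \sum_(C : K) (Q C)%:R = #|[set C | Q C]|%:R :> R.
Proof.
rewrite -sum1_card natr_sum [RHS]big_mkcond /=; apply: eq_bigr => C _.
by rewrite finset.in_set; case: (Q C).
Qed.

Lemma root_sqr : root * root = n%:R.
Proof. by rewrite -expr2 sqr_sqrtr. Qed.

Lemma root_ge1 : 1 <= root.
Proof. by rewrite /root -[leLHS]sqrtr1 ler_wsqrtr // ler1n. Qed.

Lemma fiber_gt0 : 0 < fiber.
Proof. by rewrite ltr0n muln_gt0 !expn_gt0 n0. Qed.

Lemma rate_gt0 : 0 < rate.
Proof.
by rewrite invr_gt0 mulr_gt0 ?fiber_gt0 // exprn_gt0 // (lt_le_trans _ root_ge1).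
Qed.

Lemma rate_fiber : rate * fiber <= 1.
Proof.
rewrite /rate invfM -mulrA mulVf ?mulr1 ?gt_eqF ?fiber_gt0 //.
by rewrite invf_le1 ?exprn_ege1 ?root_ge1 // exprn_gt0 // (lt_le_trans _ root_ge1).
Qed.

Lemma size_le_arity : (size l <= k)%N.
Proof. by rewrite -(card_uniqP ul) -[leqRHS]card_ord max_card. Qed.

Lemma size_split : size l = (half l + half l + odd (size l))%N.
Proof. by rewrite -{1}(odd_double_half (size l)) addnn addnC. Qed.

Lemma side_uniq o : uniq (side l o ++ odd_part l).
Proof.
have := ul; rewrite -{1}(side_cat l); case: o; rewrite -!catA cat_uniq.
  by rewrite has_cat negb_or cat_uniq cat_uniq => /and3P[-> /andP[_ ->] /and3P[_ _ ->]].
by case/and3P.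
Qed.

Lemma same_sym r C D : same r C D = same r D C.
Proof. exact: eq_sym. Qed.

Lemma count_side o ds D :
  \sum_(C : K) ((digits (side l o) C == ds) && same (odd_part l) D C)%:R <= fiber.
Proof.
rewrite sum_pred ler_nat.
have := card_digits P n0 (ds ++ digits (odd_part l) D) (side_uniq o).
rewrite size_cat size_side size_odd_part => /(leq_trans _); apply.
apply: subset_leq_card; apply/fintype.subsetP => C; rewrite !finset.in_set.
move=> /andP[/eqP <- /eqP sD]; apply/eqP; rewrite /digits map_cat; congr (_ ++ _).
by apply/esym; apply: code_inj sD; rewrite ?digits_lt ?size_digits.
Qed.

Lemma count_side_only o ds :
  \sum_(C : K) (digits (side l o) C == ds)%:R <= n%:R ^+ odd (size l) * fiber.
Proof.
have us : uniq (side l o) by have := side_uniq o; rewrite cat_uniq => /and3P[].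
rewrite sum_pred /fiber -natrX -natrM ler_nat.
apply: leq_trans (card_digits P n0 ds us) _.
rewrite size_side mulnCA leq_mul2l; apply/orP; right.
rewrite -expnD leq_pexp2l //; have := size_le_arity; have := size_split; lia.
Qed.

Lemma count_seq L : \sum_(C : K) (C \in L)%:R <= (size L)%:R :> R.
Proof.
rewrite sum_pred ler_nat (eq_card (B := mem L)) ?card_size // => C.
by rewrite finset.in_set.
Qed.

Lemma vertex_split o C D u : vertex l o C D = u ->
  digits (side l o) C = take (half l) (decode n (half l + half l) u) /\
  digits (side l o) D = drop (half l) (decode n (half l + half l) u).
Proof.
move=> <-; have := @decode_code n (digits (side l o) C ++ digits (side l o) D).
rewrite all_cat !digits_lt size_cat !size_digits size_side => /(_ isT) ->.
by rewrite take_size_cat ?drop_size_cat // size_digits size_side.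
Qed.

(* A step either repeats an earlier constraint or pays [rate]; the pairs with a
   common odd part are so few that [rate ^+ 2] times their number is 1. *)
Lemma step_bound (M : nat) o u L : (size L <= 2 * M)%N ->
  \sum_(C : K) \sum_(C' : K) (linked l C C' && (vertex l o C C' == u))%:R *
    rate ^+ ((C \notin L) + (C' \notin L)) <= (2 * M + 1)%:R ^+ 2.
Proof.
move=> LM; have z0 := rate_gt0; have z0' := ltW z0.
pose d1 := take (half l) (decode n (half l + half l) u).
pose d2 := drop (half l) (decode n (half l + half l) u).
pose a C : R := (C \in L)%:R.
pose A C : R := (digits (side l o) C == d1)%:R.
pose S C C' : R := ((digits (side l o) C' == d2) && same (odd_part l) C C')%:R.
pose S' C C' : R := ((digits (side l o) C == d1) && same (odd_part l) C' C)%:R.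
apply: (@le_trans _ _ (\sum_(C : K) \sum_(C' : K) (a C * a C' + rate * (a C * S C C') +
    rate * (a C' * S' C C') + rate ^+ 2 * (A C * S C C')))).
  apply: ler_sum => C _; apply: ler_sum => C' _.
  have rest : 0 <= a C * a C' + rate * (a C * S C C') + rate * (a C' * S' C C') +
      rate ^+ 2 * (A C * S C C').
    by rewrite !addr_ge0 ?mulr_ge0 ?exprn_ge0 ?ler0n.
  case: andP => [[/andP[s _] /eqP /vertex_split[e1 e2]]|_]; last by rewrite mul0r.
  rewrite mul1r /a /A /S /S' e1 e2 !eqxx s /= [same _ C' C]same_sym s.
  rewrite !mulr1.
  by case: (C \in L); case: (C' \in L); rewrite /= ?expr0 ?expr1 ?mulr1 ?mulr0 ?mul1r ?mul0r; nra.
under eq_bigr do rewrite !big_split /=.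
rewrite !big_split /=.
have aL : \sum_(C : K) a C <= (2 * M)%:R by apply: le_trans (count_seq L) _; rewrite ler_nat.
have a0 C : 0 <= a C by rewrite ler0n.
have A0 C : 0 <= A C by rewrite ler0n.
have S0 C C' : 0 <= S C C' by rewrite ler0n.
have f0 := ltW fiber_gt0.
have h1 : \sum_(C : K) \sum_(C' : K) a C * a C' <= (2 * M)%:R * (2 * M)%:R.
  by rewrite -big_distrlr ler_pM // sumr_ge0.
have h2 : \sum_(C : K) \sum_(C' : K) rate * (a C * S C C') <= rate * ((2 * M)%:R * fiber).
  under eq_bigr do rewrite -!big_distrr /=.
  rewrite -big_distrr /= ler_wpM2l //.
  apply: (@le_trans _ _ (\sum_(C : K) a C * fiber)).
    by apply: ler_sum => C _; rewrite ler_wpM2l // count_side.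
  by rewrite -big_distrl ler_wpM2r.
have h3 : \sum_(C : K) \sum_(C' : K) rate * (a C' * S' C C') <= rate * ((2 * M)%:R * fiber).
  rewrite exchange_big /=; under eq_bigr do rewrite -!big_distrr /=.
  rewrite -big_distrr /= ler_wpM2l //.
  apply: (@le_trans _ _ (\sum_(C : K) a C * fiber)).
    by apply: ler_sum => C _; rewrite ler_wpM2l // count_side.
  by rewrite -big_distrl ler_wpM2r.
have h4 : \sum_(C : K) \sum_(C' : K) rate ^+ 2 * (A C * S C C') <= 1.
  under eq_bigr do rewrite -!big_distrr /=.
  rewrite -big_distrr /=.
  apply: (@le_trans _ _ (rate ^+ 2 * ((n%:R ^+ odd (size l) * fiber) * fiber))).
    rewrite ler_wpM2l ?exprn_ge0 //.
    apply: (@le_trans _ _ (\sum_(C : K) A C * fiber)).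
      by apply: ler_sum => C _; rewrite ler_wpM2l // count_side.
    by rewrite -big_distrl ler_wpM2r // count_side_only.
  rewrite -root_sqr exprMn /rate.
  set y := root ^+ _; have y0 : 0 < y.
    by rewrite exprn_gt0 // (lt_le_trans _ root_ge1).
  have inv2 (b c : R) : b != 0 -> c != 0 -> (b * c)^-1 ^+ 2 * (b * b * c * c) = 1.
    by move=> b0 c0; field; rewrite b0 c0.
  by rewrite inv2 // gt_eqF // fiber_gt0.
have h5 : rate * ((2 * M)%:R * fiber) <= (2 * M)%:R.
  by rewrite mulrCA ler_piMr // rate_fiber.
rewrite natrD expr2; nra.
Qed.


(** The part of the price [p] of a constraint that remains once [rate] has paid for its choice. By
    [growthE] it is the mean size divided by n^(s/2). *)
Definition growth : R := p / rate.

Let p0 : 0 <= p. Proof. by case/andP: p01. Qed.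

Lemma rateE : rate * growth = p.
Proof. by rewrite /growth mulrCA divff ?mulr1 // gt_eqF // rate_gt0. Qed.

Lemma undup2 L C D : C != D ->
  size (undup [:: C, D & L]) = ((C \notin L) + (D \notin L) + size (undup L))%N.
Proof.
move=> CD; rewrite /= !inE (negbTE CD) /=.
by case: (C \in L); case: (D \in L).
Qed.

Lemma linked_neq C D : linked l C D -> C != D.
Proof. by apply: contraTneq => ->; rewrite /linked /same !eqxx. Qed.

(** Each distinct constraint weighs [p = rate * growth]. The powers of [rate] are spent step by step
    through [step_bound], with a factor 2 for the orientation. At the end at most half of the list
    is distinct, and [1 <= growth] allows to raise its exponent to [a + j]. *)
Lemma walks_bound (M j a : nat) u L : 1 <= growth ->
  size L = (2 * a)%N -> (a + j <= M)%N ->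
  walks p l j u L <= growth ^+ (a + j) * rate ^+ size (undup L) *
    (2 * (2 * M + 1)%:R ^+ 2) ^+ j.
Proof.
move=> Y1; have z0 := ltW rate_gt0; have Y0 : 0 <= growth by apply: le_trans Y1.
elim: j a u L => [|j IH] a u L La aM.
  rewrite addn0 expr0 mulr1 /= /weight_of; case: ifP => [rL|_].
    rewrite -[X in X ^+ _]rateE exprMn mulrC ler_wpM2r ?exprn_ge0 //.
    by apply: ler_weXn2l => //; have := repeated_size rL; lia.
  by rewrite mulr_ge0 ?exprn_ge0.
set B := 2 * (2 * M + 1)%:R ^+ 2.
rewrite [leLHS]/=.
apply: (@le_trans _ _ (\sum_(C : K) \sum_(C' : K) \sum_(o : bool)
   (growth ^+ (a + j.+1) * rate ^+ size (undup L) * B ^+ j) *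
   ((linked l C C' && (vertex l o C C' == u))%:R *
    rate ^+ ((C \notin L) + (C' \notin L))))).
  apply: ler_sum => C _; apply: ler_sum => C' _; apply: ler_sum => o _.
  case: andP => [[lk _]|_]; last by rewrite !mul0r mulr0.
  rewrite !mul1r; apply: le_trans (IH a.+1 _ _ _ _) _.
  - by rewrite /= La; lia.
  - by lia.
  rewrite (undup2 _ (linked_neq lk)) addSnnS [rate ^+ _]exprD le_eqVlt; apply/orP; left; apply/eqP.
  by rewrite -/B -!mulrA; congr (_ * _); rewrite mulrC -mulrA.
under eq_bigr do under eq_bigr do rewrite -big_distrr /=.
under eq_bigr do rewrite -big_distrr /=.
rewrite -big_distrr /= [in leRHS]exprSr [leRHS]mulrA ler_wpM2l //.
  by rewrite !mulr_ge0 ?exprn_ge0 // mulr_ge0 // exprn_ge0.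
under eq_bigr do rewrite exchange_big /=.
rewrite exchange_big /= big_bool /= /B.
have LM : (size L <= 2 * M)%N by lia.
by have := step_bound true u LM; have := step_bound false u LM; lra.
Qed.

(** By symmetry the squared Frobenius norm of the M-th power is the trace of the power 2M. The walks
    then have 2M steps and list at most 4M constraints, whence 4M + 1. Summing over the starting
    vertex gives the dimension. *)
Lemma mean_trace (M : nat) : 1 <= growth -> (0 < M)%N ->
  mean p (fun J => \sum_u \sum_v (link_matrix R l (enum J) ^+ M) u v ^+ 2) <=
  (dim n l)%:R * (growth * (2 * (2 * (2 * M) + 1)%:R ^+ 2)) ^+ (2 * M).
Proof.
move=> Y1 M0.
rewrite (@eq_mean _ _ _ _ _ _ (fun J => \sum_u (link_matrix R l (enum J) ^+ (2 * M)) u u)).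
  rewrite mean_sum; set B := 2 * _.
  apply: (@le_trans _ _ (\sum_(u < dim n l) (growth * B) ^+ (2 * M))); last first.
    by rewrite sumr_const card_ord mulr_natl.
  apply: ler_sum => u _; apply: le_trans (ler_norm _) _.
  rewrite (@eq_mean _ _ _ _ _ _ (fun J => \prod_(C <- [::]) eta p C J *
    (link_matrix R l (enum J) ^+ (2 * M)) u u)).
    2: by move=> J; rewrite big_nil mul1r.
  apply: le_trans (mean_walks p01 ul l0 (2 * M) u u [::]) _.
  have := @walks_bound (2 * M) (2 * M) 0 u [::] Y1 erefl (leqnn _).
  by rewrite add0n /= expr0 mulr1 -exprMn.
move=> J; apply: eq_bigr => u _; rewrite mulSn mul1n exprD mxE; apply: eq_bigr => v _.
rewrite expr2; congr (_ * _).
have H := link_matrix_sym R l (enum J).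
have : (link_matrix R l (enum J) ^+ M)^T = link_matrix R l (enum J) ^+ M.
  elim: (M) => [|i IH]; first by rewrite !expr0 trmx1.
  by rewrite {1}exprSr -[LHS]/((_ *m _)^T) trmx_mul IH H -[LHS]/(_ * _) -exprS.
by move=> {1}<-; rewrite mxE.
Qed.

Lemma mean_pair C D : `|mean p (fun J => eta p C J * eta p D J)| <= (C == D)%:R * p.
Proof.
have := mean_eta p01 [:: C; D].
rewrite (@eq_mean _ _ _ _ _ _ (fun J => eta p C J * eta p D J)).
  2: by move=> J; rewrite big_cons big_seq1.
rewrite /weight_of /repeated /= inE; case: (eqVneq C D) => [<-|CD].
  by rewrite !eqxx /= expr1 mul1r.
by rewrite !eqxx mul0r.
Qed.

(** Two distinct centered indicators have a product of mean 0, so only the terms with [C = D]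
    remain, each at most [b * p]. *)
Lemma mean_quadratic (F : K -> K -> R) (b : R) : (forall C D, `|F C D| <= b) ->
  mean p (fun J => \sum_C \sum_D (eta p C J * eta p D J) * F C D) <= b * (p * #|{: K}|%:R).
Proof.
move=> Fb; rewrite mean_sum mulrA mulr_natr -sumr_const; apply: ler_sum => C _.
rewrite mean_sum; apply: (@le_trans _ _ (\sum_D b * ((C == D)%:R * p))).
  apply: ler_sum => D _; rewrite (@eq_mean _ _ _ _ _ _ (fun J => F C D * (eta p C J * eta p D J))).
    rewrite meanZ (le_trans (ler_norm _)) // normrM ler_pM //; exact: mean_pair.
  by move=> J; rewrite mulrC.
rewrite (bigD1 C) //= eqxx mul1r big1 ?addr0 // => D.
by rewrite eq_sym => /negbTE ->; rewrite mul0r mulr0.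
Qed.

Lemma mean_diagonal : mean p (fun J => signed_diagonal R l (enum J)) <= p * #|{: K}|%:R.
Proof.
rewrite (eq_mean _ (signed_diagonal_eta p ul l0)) -[leRHS]mul1r.
apply: (mean_quadratic (F := fun C D =>
  (diagonal l C D)%:R * (chi R l C * chi R l D))) => C D.
rewrite !normrM !norm_chi !mulr1 normr_nat.
by case: diagonal.
Qed.

Lemma mean_size_sqr :
  mean p (fun J : {set K} => (#|J|%:R - p * #|{: K}|%:R) ^+ 2) <= p * #|{: K}|%:R.
Proof.
rewrite -[leRHS]mul1r; rewrite (@eq_mean _ _ _ _ _ _
  (fun J => \sum_C \sum_D (eta p C J * eta p D J) * (fun _ _ => 1) C D)).
  by apply: mean_quadratic => _ _; rewrite normr1.
move=> J; have -> : #|J|%:R - p * #|{: K}|%:R = \sum_C eta p C J.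
  rewrite sumrB sumr_const; congr (_ - _); last by rewrite mulr_natr.
  rewrite -sum1_card natr_sum big_mkcond.
  by apply: eq_bigr => C _; case: (C \in J).
rewrite expr2 big_distrlr; apply: eq_bigr => C _; apply: eq_bigr => D _ /=.
by rewrite mulr1.
Qed.

Lemma card_constraint : #|{: K}|%:R = 2 ^+ k * n%:R ^+ k :> R.
Proof. by rewrite card_prod !card_ffun card_bool !card_ord natrM !natrX. Qed.

Lemma growthE : growth * root ^+ size l = Defs.mean_size k n p.
Proof.
have rs : root ^+ size l = n%:R ^+ half l * root ^+ odd (size l).
  by rewrite {1}size_split !exprD -exprMn root_sqr.
have nk : n%:R ^+ k = n%:R ^+ (k - (half l + odd (size l))) *
    (n%:R ^+ half l * (root ^+ odd (size l) * root ^+ odd (size l))) :> R.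
  rewrite -exprMn root_sqr -!exprD subnK //.
  by have := size_le_arity; have := size_split; lia.
rewrite /growth /rate invrK /Defs.mean_size nk rs /fiber natrM !natrX; ring.
Qed.

End Count.

(** * Tail bounds for the size and for each test *)

Section Failure.
Variables (R : realType) (k : nat) (P : predicate k) (n : nat) (p : R) (g : nat).
Hypotheses (p01 : 0 <= p <= 1) (n0 : (0 < n)%N) (g0 : (0 < g)%N).
Local Notation K := (constraint P n).
Local Notation mu := (mean_size k n p).
Hypothesis mu0 : 0 < mu.
Implicit Types (C D : K) (J : {set K}) (I : instance P n) (l : seq 'I_k).

Lemma mean_sizeE : mu = p * #|{: K}|%:R.
Proof. by rewrite /mean_size card_constraint mulrC. Qed.

(** Chebyshev's inequality, the variance being at most [mu]. The thresholds of the tests use the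
    actual number of constraints, which must therefore not fall far below its mean. *)
Lemma prob_few_constraints : prob p (fun J : {set K} => #|J|%:R < mu / 2) <= 4 / mu.
Proof.
have := @markov_mean R k P n p p01 (fun J => (#|J|%:R - mu) ^+ 2)
  (fun J => #|J|%:R < mu / 2) ((mu / 2) ^+ 2) mu.
have -> : mu / (mu / 2) ^+ 2 = 4 / mu by field; rewrite gt_eqF.
apply.
- by rewrite exprn_gt0 // divr_gt0.
- by move=> J; exact: sqr_ge0.
- move=> J /= hJ; rewrite -[leRHS]sqrrN opprB.
  by move: mu mu0 hJ => m m0 hJ; apply: lerXn2r; rewrite ?nnegrE; lra.
- by rewrite mean_sizeE; exact: mean_size_sqr.
Qed.

(** Grouping the constraints by their variables on the blocks and on the odd coordinate makes this a
    sum of squares. Markov's inequality requires the sign. *)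
Lemma signed_diagonal_ge0 l I : 0 <= signed_diagonal R l I.
Proof.
set e := (n ^ odd (size l))%N; set d := (n ^ (half l + half l))%N.
pose uv := side l true ++ side l false.
pose cu C := code n (digits uv C); pose co C := code n (digits (odd_part l) C).
have cud C : (cu C < d)%N.
  have := @code_lt n (digits uv C).
  by rewrite digits_lt size_digits size_cat !size_side; apply.
have coe C : (co C < e)%N by exact: code_odd_lt.
pose q (y w : nat) : R := \sum_(C <- I) (co C == y)%:R * ((cu C == w)%:R * chi R l C).
suff -> : signed_diagonal R l I = \sum_(y < e) \sum_(w < d) q y w ^+ 2.
  by do 2!(apply: sumr_ge0 => ? _); exact: sqr_ge0.
rewrite /signed_diagonal.
under [RHS]eq_bigr do under eq_bigr do rewrite expr2 big_distrlr /=.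
under [RHS]eq_bigr do rewrite exchange_big /=.
rewrite [RHS]exchange_big; apply: eq_bigr => C _ /=.
under [RHS]eq_bigr do rewrite exchange_big /=.
rewrite [RHS]exchange_big; apply: eq_bigr => D _ /=.
under [RHS]eq_bigr do under eq_bigr do rewrite mulrACA -mulrA.
under [RHS]eq_bigr do rewrite -!big_distrr /=.
rewrite (sum_delta (fun y => (co D == y)%:R * \sum_(w < d)
   ((cu C == w)%:R * chi R l C * ((cu D == w)%:R * chi R l D)))) //.
under [in RHS]eq_bigr do rewrite mulrACA -mulrA.
rewrite (sum_delta (fun w => (cu D == w)%:R * (chi R l C * chi R l D))) //.
rewrite [RHS]mulrA -natrM mulnb /diagonal /same -/(cu _) -/(co _).
by rewrite [co C == _]eq_sym [cu C == _]eq_sym.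
Qed.

Lemma prob_diagonal l : uniq l -> (0 < size l)%N ->
  prob p (fun J => (mu / 2 <= #|J|%:R) &&
    ~~ (2 * (g%:R ^+ 2 * n%:R ^+ odd (size l)) * signed_diagonal R l (enum J)
        <= #|J|%:R ^+ 2)) <= 8 * g%:R ^+ 2 * n%:R ^+ odd (size l) / mu.
Proof.
move=> ul l0; set c := g%:R ^+ 2 * n%:R ^+ odd (size l).
have c0 : 0 < c by rewrite mulr_gt0 // exprn_gt0 ?ltr0n.
have -> : 8 * g%:R ^+ 2 * n%:R ^+ odd (size l) / mu = mu / ((mu / 2) ^+ 2 / (2 * c)).
  rewrite -[8 * _ * _]mulrA -/c; field; by rewrite !gt_eqF.
apply: (markov_mean p01 (f := fun J => signed_diagonal R l (enum J))).
- by rewrite divr_gt0 ?exprn_gt0 ?divr_gt0 // mulr_gt0.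
- by move=> J; exact: signed_diagonal_ge0.
- move=> J /andP[hJ]; rewrite -ltNge => h.
  have c2 : 0 < 2 * c by rewrite mulr_gt0.
  rewrite (ler_pdivrMr _ _ c2) [_ * (2 * c)]mulrC; apply: le_trans (ltW h).
  have hm : 0 <= mu / 2 by rewrite divr_ge0 // ltW.
  by apply: lerXn2r; rewrite ?nnegrE.
- by rewrite mean_sizeE; exact: mean_diagonal.
Qed.

Lemma prob_frobenius l (N : nat) : uniq l -> (0 < size l)%N -> (0 < N)%N ->
  root R n ^+ size l <= mu ->
  prob p (fun J => (mu / 2 <= #|J|%:R) &&
    ~~ (\sum_u \sum_v (((scale n g l)%:R *: link_matrix R l (enum J)) ^+ N) u v ^+ 2
        <= (#|J|%:R ^+ 2) ^+ (2 * N))) <=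
  (dim n l)%:R * (8 * g%:R ^+ 2 * (4 * N + 1)%:R ^+ 2 * (root R n ^+ size l / mu)) ^+ (2 * N).
Proof.
move=> ul l0 N0 rmu.
have r0 : 0 < root R n ^+ size l by rewrite exprn_gt0 // (lt_le_trans _ (root_ge1 R n0)).
have Y1 : 1 <= growth n p l by rewrite -(ler_pM2r r0) mul1r growthE.
have s0 : 0 < (scale n g l)%:R :> R.
  by rewrite ltr0n !muln_gt0 g0 !expn_gt0 n0.
set B : R := 8 * _ * _.
(* The quotient in Markov's inequality, simplified by [growth = mu / root ^ s] and
   [scale = g ^ 2 * root ^ (2 s)]; the 8 is 2 from the orientations times 4 from [mu / 2]
   squared. *)
have -> : (dim n l)%:R * (B * (root R n ^+ size l / mu)) ^+ (2 * N) =
    ((dim n l)%:R * (growth n p l * (2 * (2 * (2 * N) + 1)%:R ^+ 2)) ^+ (2 * N)) /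
    (((mu / 2) ^+ 2) ^+ (2 * N) / (scale n g l)%:R ^+ (2 * N)).
  rewrite -[RHS]mulrA -expr_div_n -exprVn -exprMn; congr (_ * _ ^+ _).
  have -> : (2 * (2 * N) + 1 = 4 * N + 1)%N by rewrite mulnA.
  have gE : growth n p l = mu / root R n ^+ size l.
    by rewrite -(growthE p01 n0 ul l0) mulfK // gt_eqF.
  have -> : (scale n g l)%:R = g%:R ^+ 2 * (root R n ^+ size l) ^+ 2 :> R.
    rewrite /scale /dim !natrM !natrX -!expr2 -exprM mulnC exprM [root R n ^+ 2]expr2.
    rewrite (root_sqr R n) -exprD; congr (_ * _ ^+ _).
    by rewrite [in RHS]size_split addnC.
  rewrite gE /B; field.
  by rewrite (gt_eqF r0) (gt_eqF mu0) pnatr_eq0 -lt0n g0.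
apply: (markov_mean p01 (f := fun J =>
  \sum_u \sum_v (link_matrix R l (enum J) ^+ N) u v ^+ 2)).
- by rewrite divr_gt0 // !exprn_gt0 // divr_gt0.
- by move=> J; do 2!(apply: sumr_ge0 => ? _); exact: sqr_ge0.
- move=> J /andP[hJ]; rewrite -ltNge => h.
  have e (a : R) (A : 'M[R]_(dim n l)) i : (a *: A) ^+ i = a ^+ i *: A ^+ i.
    elim: i => [|i IH]; first by rewrite !expr0 scale1r.
    by rewrite !exprS IH -[LHS]/(_ *m _) -scalemxAl -scalemxAr scalerA.
  have : ((mu / 2) ^+ 2) ^+ (2 * N) <=
      (scale n g l)%:R ^+ (2 * N) * \sum_u \sum_v (link_matrix R l (enum J) ^+ N) u v ^+ 2.
    apply: (@le_trans _ _ ((#|J|%:R ^+ 2) ^+ (2 * N))).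
      have hm : 0 <= mu / 2 by rewrite divr_ge0 // ltW.
      by rewrite !lerXn2r ?nnegrE ?exprn_ge0.
    apply: le_trans (ltW h) _; rewrite le_eqVlt; apply/orP; left; apply/eqP.
    rewrite e big_distrr; apply: eq_bigr => u _ /=; rewrite big_distrr.
    by apply: eq_bigr => v _ /=; rewrite mxE exprMn -exprM mulnC.
  by rewrite ler_pdivrMr ?exprn_gt0 // [leRHS]mulrC.
- exact: mean_trace.
Qed.

End Failure.

(** * Failure probability *)

Section Union.
Variables (R : realType) (k : nat) (P : predicate k) (n : nat) (p : R) (g t : nat).
Hypotheses (p01 : 0 <= p <= 1) (n0 : (0 < n)%N) (g0 : (0 < g)%N).
Local Notation K := (constraint P n).
Local Notation mu := (mean_size k n p).
Hypotheses (mu0 : 0 < mu) (rmu : root R n ^+ t <= mu).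

Lemma low_degreeP (l : seq 'I_k) : l \in low_degree k t ->
  [/\ uniq l, (0 < size l)%N & (size l <= t)%N].
Proof.
move=> /mapP[A]; rewrite mem_enum finset.in_set => /andP[A0 At] ->.
by rewrite enum_uniq -cardE.
Qed.

Lemma prob_failure :
  prob_random_csp p (fun I : instance P n => ~ asserts (certifyP g (low_degree k t)) I)
  <= 4 / mu + \sum_(l <- low_degree k t)
     (8 * g%:R ^+ 2 * n%:R ^+ odd (size l) / mu +
      (dim n l)%:R * (8 * g%:R ^+ 2 * (4 * 2 ^ rounds n + 1)%:R ^+ 2 *
         (root R n ^+ size l / mu)) ^+ (2 * 2 ^ rounds n)).
Proof.
pose few (J : {set K}) := #|J|%:R < mu / 2.
pose bad1 (l : seq 'I_k) (J : {set K}) := (mu / 2 <= #|J|%:R) &&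
    ~~ (2 * (g%:R ^+ 2 * n%:R ^+ odd (size l)) * signed_diagonal R l (enum J)
        <= #|J|%:R ^+ 2).
pose bad2 (l : seq 'I_k) (J : {set K}) := (mu / 2 <= #|J|%:R) &&
    ~~ (\sum_u \sum_v (((scale n g l)%:R *: link_matrix R l (enum J)) ^+ (2 ^ rounds n)) u v ^+ 2
        <= (#|J|%:R ^+ 2) ^+ (2 * 2 ^ rounds n)).
apply: (@le_trans _ _ (prob p (fun J =>
  few J || has (fun l => bad1 l J || bad2 l J) (low_degree k t)))).
  apply: (prob_le p01) => J /asboolP; rewrite certify_asserts ?low_degree_size //.
  move=> /negP /allPn[l lt]; rewrite (passesE R) -cardE negb_and => hp.
  rewrite /few; case: ltP => //= hm; apply/hasP; exists l => //.
  by rewrite /bad1 /bad2 hm.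
apply: le_trans (prob_union p01 _ _) _; apply: lerD; first exact: prob_few_constraints.
apply: le_trans (prob_has p01 _ (fun l J => bad1 l J || bad2 l J)) _.
rewrite big_seq [leRHS]big_seq; apply: ler_sum => l /low_degreeP[ul l0 lt].
apply: le_trans (prob_union p01 _ _) _; apply: lerD; first exact: prob_diagonal.
apply: prob_frobenius => //; first by rewrite expn_gt0.
by apply: le_trans rmu; rewrite ler_weXn2l // root_ge1.
Qed.

End Union.

(** * Estimates for large n *)

Section Asymptotics.
Variable R : realType.

Lemma powR_root (n t : nat) : n%:R `^ (t%:R / 2) = root R n ^+ t.
Proof.
rewrite mulrC powRrM powR12_sqrt // powR_mulrn //; exact: sqrtr_ge0.
Qed.

Lemma ln2_ge_half : 2^-1 <= ln 2 :> R.
Proof.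
have : ln (1 + (- 2^-1)) <= - 2^-1 :> R by apply: le_ln1Dx; lra.
have -> : 1 + - 2^-1 = 2^-1 :> R by lra.
by rewrite lnV ?posrE // lerN2.
Qed.

(** For r = [rounds n] > 0, minimality gives 2^(r - 1) ln 2 <= ln n, and ln 2 >= 1/2 yields the
    constant 4. *)
Lemma exp_rounds_le_ln n : 1 <= ln n%:R :> R -> (2 ^ rounds n)%:R <= 4 * ln n%:R :> R.
Proof.
move=> ln1; case e: (rounds n) => [|r]; first by rewrite expn0; lra.
have : ~~ (n <= 2 ^ 2 ^ r)%N by rewrite rounds_le e ltnn.
rewrite -ltnNge => /ltnW h.
have n0 : (0 < n)%N by apply: leq_trans h; rewrite expn_gt0.
have : ln (2 ^+ (2 ^ r)) <= ln n%:R :> R.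
  by rewrite ler_ln ?posrE ?exprn_gt0 ?ltr0n // -natrX ler_nat.
rewrite lnXn // -[_ *+ (2 ^ r)]mulr_natr expnS natrM => h'.
have : 2^-1 * (2 ^ r)%:R <= ln 2 * (2 ^ r)%:R :> R by rewrite ler_wpM2r // ln2_ge_half.
by lra.
Qed.

(* The error is [n ^ k] times the power [2 * 2 ^ rounds n >= 2 * log2 n] of a
   quantity tending to 0. *)
Lemma frobenius_tail (k n d : nat) (b x c : R) : 1 <= ln n%:R :> R -> 0 <= b -> 0 <= x ->
  (d <= n ^ k)%N -> x <= c / ln n%:R ^+ 5 ->
  b * 289 * c * 2 ^+ k.+1 <= ln n%:R ->
  d%:R * (b * (4 * 2 ^ rounds n + 1)%:R ^+ 2 * x) ^+ (2 * 2 ^ rounds n) <= n%:R^-1.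
Proof.
move=> ln1 b0 x0 dn xc hK.
have n0 : (0 < n)%N.
  by rewrite lt0n; apply: contraTneq ln1 => ->; rewrite ln0 // -ltNge.
have := exp_rounds_le_ln ln1; set y := ln n%:R in ln1 xc hK * => hr.
have y0 : 0 < y by apply: lt_le_trans ln1.
have c0 : 0 <= c.
  have := le_trans x0 xc; rewrite ler_pdivlMr ?exprn_gt0 //.
  by rewrite mul0r.
set N := (2 ^ rounds n)%N.
(* 17 = 4 * 4 + 1, from [N <= 4 * y] and [1 <= y]; its square is the 289 of the hypothesis. *)
have hN : (4 * N + 1)%:R <= 17 * y :> R.
  rewrite natrD natrM; move: hr; rewrite -/N; lra.
have base_le : b * (4 * N + 1)%:R ^+ 2 * x <= (2 ^+ k.+1)^-1.
  apply: (@le_trans _ _ (b * (17 * y) ^+ 2 * (c / y ^+ 5))).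
    rewrite ler_pM ?mulr_ge0 ?exprn_ge0 // ler_wpM2l //.
    by rewrite lerXn2r ?nnegrE // mulr_ge0 // ltW.
  have -> : b * (17 * y) ^+ 2 * (c / y ^+ 5) = (b * 289 * c) / y ^+ 3.
    by field; rewrite gt_eqF.
  rewrite ler_pdivrMr ?exprn_gt0 // [leRHS]mulrC ler_pdivlMr ?exprn_gt0 //.
  apply: le_trans hK _; rewrite -[leLHS]mulr1 exprS ler_wpM2l ?exprn_ege1 // ltW //.
have nN : (n <= 2 ^ N)%N by rewrite rounds_le.
(* As [n <= 2 ^ N], the power [2 * N] of [2 ^ k.+1] is at least [n ^ k.+1]: k factors pay for [d]
   and one remains. *)
have hp : (b * (4 * N + 1)%:R ^+ 2 * x) ^+ (2 * N) <= (n%:R ^+ k.+1)^-1.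
  apply: (@le_trans _ _ ((2 ^+ k.+1)^-1 ^+ (2 * N))).
    by rewrite lerXn2r ?nnegrE ?invr_ge0 ?exprn_ge0 // !mulr_ge0 ?exprn_ge0.
  rewrite exprVn lef_pV2 ?posrE ?exprn_gt0 ?ltr0n //.
  rewrite -exprM mulnC exprM lerXn2r ?nnegrE ?exprn_ge0 //.
  rewrite -natrX ler_nat (leq_trans nN) // leq_exp2l //; lia.
apply: (@le_trans _ _ (n%:R ^+ k * (n%:R ^+ k.+1)^-1)).
  rewrite ler_pM //; last by rewrite -natrX ler_nat.
  by rewrite exprn_ge0 // !mulr_ge0 ?exprn_ge0.
by rewrite exprSr invfM mulrA divff ?mul1r // gt_eqF // exprn_gt0 // ltr0n.
Qed.

End Asymptotics.

Section FailureBound.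
Variable R : realType.

Lemma failure_le (k : nat) (P : predicate k) (n t g : nat) (p gamma : R) :
  0 <= p <= 1 -> (2 <= t)%N -> (t <= k)%N -> (0 < g)%N -> 0 < gamma ->
  1 <= ln n%:R :> R -> gamma ^+ 2 <= ln n%:R ->
  8 * g%:R ^+ 2 * 289 * gamma ^+ 2 * 2 ^+ k.+1 <= ln n%:R ->
  root R n ^+ t * ln n%:R ^+ 5 / gamma ^+ 2 <= mean_size k n p ->
  prob_random_csp p (fun I : instance P n => ~ asserts (certifyP g (low_degree k t)) I)
  <= (4 * gamma ^+ 2 + (size (low_degree k t))%:R * (8 * g%:R ^+ 2 * gamma ^+ 2 + 1))
     / ln n%:R.
Proof.
move=> p01 t2 tk g0 gamma0 ln1 lnc lnK hmu.
have n0 : (0 < n)%N.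
  by rewrite lt0n; apply: contraTneq ln1 => ->; rewrite ln0 // -ltNge.
have c0 : 0 < gamma ^+ 2 by rewrite exprn_gt0.
set c := gamma ^+ 2 in lnc lnK hmu c0 *.
have lnn : ln n%:R <= n%:R :> R by rewrite ltW // ln_sublinear // ltr0n.
have tail_ := @frobenius_tail R k n.
set y := ln n%:R in ln1 lnc lnK hmu lnn tail_ *.
have y0 : 0 < y by apply: lt_le_trans ln1.
have yc a : 0 <= a -> a / y ^+ 5 <= a / y.
  by move=> a0; rewrite ler_wpM2l // lef_pV2 ?posrE ?exprn_gt0 // exprS ler_peMr ?exprn_ege1 // ltW.
have r1 := root_ge1 R n0.
have rt1 : 1 <= root R n ^+ t by rewrite exprn_ege1.
have rt0 : 0 < root R n ^+ t by apply: lt_le_trans rt1.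
have mu0 : 0 < mean_size k n p.
  by apply: lt_le_trans hmu; rewrite divr_gt0 // mulr_gt0 // exprn_gt0.
(* This makes [growth] at least 1 for all sets of at most [t] coordinates. *)
have rmu : root R n ^+ t <= mean_size k n p.
  apply: le_trans hmu; rewrite -mulrA ler_peMr ?(ltW rt0) // ler_pdivlMr // mul1r.
  by rewrite (le_trans lnc) // exprS ler_peMr ?exprn_ege1 // ltW.
have quot : root R n ^+ t / mean_size k n p <= c / y ^+ 5.
  rewrite ler_pdivrMr // mulrAC ler_pdivlMr ?exprn_gt0 //.
  by move: hmu; rewrite ler_pdivrMr // [leRHS]mulrC.
have quot_le a : a <= root R n ^+ t -> a / mean_size k n p <= c / y ^+ 5.
  by move=> ar; apply: le_trans quot; rewrite ler_pM2r ?invr_gt0.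
apply: le_trans (prob_failure P p01 n0 g0 mu0 rmu) _.
rewrite [leRHS]mulrDl; apply: lerD.
  rewrite -[leRHS]mulrA ler_wpM2l //; apply: le_trans (yc _ (ltW c0)).
  by rewrite -div1r; exact: quot_le.
have sum_size (s : seq (seq 'I_k)) (x : R) : (size s)%:R * x = \sum_(l <- s) x.
  by rewrite big_const_seq count_predT iter_addr_0 mulr_natl.
rewrite -[leRHS]mulrA sum_size big_seq [leRHS]big_seq.
apply: ler_sum => l /low_degreeP[ul l0 lt]; rewrite [leRHS]mulrDl; apply: lerD.
  rewrite -[leLHS]mulrA -[leRHS]mulrA ler_wpM2l ?mulr_ge0 ?exprn_ge0 //.
  apply: le_trans (yc _ (ltW c0)); apply: quot_le.
  (* Here [2 <= t] enters: for a set of odd size the diagonal test loses a factor n, at most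
     n^(t/2). *)
  apply: (@le_trans _ _ n%:R); last by rewrite -root_sqr -expr2 ler_weXn2l.
  by case: odd; rewrite ?expr1 // expr0 ler1n.
rewrite div1r; apply: (@le_trans _ _ n%:R^-1); last first.
  by rewrite lef_pV2 ?posrE // ltr0n.
apply: (tail_ _ _ _ c) => //.
- by rewrite divr_ge0 ?exprn_ge0 ?ltW // (lt_le_trans _ r1).
- by rewrite leq_pexp2l // (leq_trans (half_le l)) // (leq_trans lt).
- by apply: quot_le; rewrite ler_weXn2l.
Qed.

End FailureBound.

Local Open Scope classical_set_scope.

Theorem theorem4p8 (R : realType) :
  exists C : nat,
  forall (k : nat) (P : predicate k) (t : nat) (gamma : R),
    (2 <= t <= k)%N -> 0 < gamma ->
  exists A : program,
    [/\ poly_time P A,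
        sound (fun n (I : instance P n) => quasirandom gamma t I) A &
        forall p : nat -> R,
          (forall n, 0 <= p n <= 1) ->
          (\forall n \near \oo,
             2 ^+ (C * t) * (n%:R `^ (t%:R / 2)) * (ln n%:R) ^+ 5 / gamma ^+ 2
               <= mean_size k n (p n)) ->
          succeeds_whp P p A].
Proof.
exists 0%N => k P t gamma /andP[t2 tk] gamma0.
(* An integer replaces [gamma^-1] in the program; rounding it up makes the tests stricter. *)
pose g := (Num.trunc gamma^-1).+1.
have gg : 1 <= g%:R * gamma.
  by rewrite -ler_pdivrMr // div1r ltW // truncnS_gt.
exists (certifyP g (low_degree k t)); split.
- exact/certify_poly_time/low_degree_size.
- move=> n I /certify_asserts => /(_ (low_degree_size k t)).
  exact: passes_quasirandom.
move=> p p01 hp; apply/cvgrPdist_le => eps eps0.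
pose b : R := 4 * gamma ^+ 2 +
  (size (low_degree k t))%:R * (8 * g%:R ^+ 2 * gamma ^+ 2 + 1).
pose a : R := 8 * g%:R ^+ 2 * 289 * gamma ^+ 2 * 2 ^+ k.+1.
have b0 : 0 <= b by rewrite addr_ge0 ?mulr_ge0 ?addr_ge0 ?mulr_ge0 ?exprn_ge0 // ltW.
have a0 : 0 <= a by rewrite !mulr_ge0 ?exprn_ge0 // ltW.
have c0 : 0 <= gamma ^+ 2 by rewrite exprn_ge0 // ltW.
have e0 : 0 <= b / eps by rewrite divr_ge0 // ltW.
near=> n.
(* All summands are nonnegative, so this one bound gives each largeness condition of [failure_le];
   the last summand brings the error below [eps]. *)
have lnn : 1 + gamma ^+ 2 + a + b / eps <= ln n%:R.
  have hn : expR (1 + gamma ^+ 2 + a + b / eps) <= n%:R.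
    by near: n; exact: nbhs_infty_ger.
  have n0 : 0 < n%:R :> R by apply: lt_le_trans hn; exact: expR_gt0.
  by rewrite -ler_expR lnK.
rewrite sub0r normrN ger0_norm; last exact: prob_ge0.
apply: le_trans (failure_le P (p01 n) t2 tk (ltn0Sn _) gamma0 _ _ _ _) _.
- by lra.
- by lra.
- by rewrite -/a; lra.
- by near: n; apply: filterS hp => n; rewrite mul0n expr0 mul1r powR_root.
rewrite -/b ler_pdivrMr; last by lra.
rewrite mulrC -ler_pdivrMr //; lra.
Unshelve. all: by end_near.
Qed.
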